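(* Let $E$ be a Euclidean Jordan algebra of rank $3$. Then the completely positive cone $\mathcal{CP}(E_+)$ over the cone of squares $E_+$ of $E$ is facially exposed if and only if $E$ is not simple.
   Context: Euclidean Jordan algebra (EJA): a finite-dimensional real vector space $E$ with a commutative bilinear product $\circ$ satisfying $x\circ((x\circ x)\circ y)=(x\circ x)\circ(x\circ y)$ for all $x,y$, with a unit element, and admitting an inner product $\bullet$ with $(x\circ y)\bullet z=x\bullet(y\circ z)$ for all $x,y,z$ (an associative inner product; fix any one). A Jordan frame is a set $\{c_1,\dots,c_r\}$ of nonzero idempotents, none of which is a sum of two nonzero idempotents, with $c_i\circ c_j=0$ for $i\ne j$ and $c_1+\dots+c_r$ equal to the unit; its cardinality $r$ does not depend on the frame and is the rank of $E$. $E_+=\{x\circ x\mid x\in E\}$ is the associated symmetric cone. A subalgebra is a subspace closed under $\circ$; two subalgebras $E_1,E_2$ are orthogonal if $x\circ y=0$ for all $x\in E_1,y\in E_2$. $E$ is simple if it is nonzero and is not the direct sum of two nonzero orthogonal subalgebras. For a closed cone $K$ in a finite-dimensional real inner product space $V$ (a cone is a set closed under multiplication by all reals $a\ge 0$), $\mathcal{CP}(K)=\{\sum_{i=1}^k a_i\otimes a_i\mid k\ge1,\ a_i\in K\}$, where $x\otimes x$ is the self-adjoint linear map $y\mapsto (x\bullet y)x$ on $V$. It lies in the space $\mathcal{S}(V)$ of self-adjoint linear transformations on $V$, with the induced inner product. A face of a closed convex cone $C$ is a nonempty convex subcone $F\subseteq C$ such that $a,b\in C$ and $a+b\in F$ imply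 $a,b\in F$. An exposed face is a set $C\cap\{d\}^\perp$ with $d$ in the dual cone $C^*=\{y\mid \langle x,y\rangle\ge0\ \forall x\in C\}$. $C$ is facially exposed if all its faces are exposed. (Facial exposedness of $\mathcal{CP}(E_+)$ does not depend on the chosen associative inner product.) *)

(* Defs.v *)
From HB Require Import structures.
From mathcomp Require Import all_boot all_order all_algebra.
From mathcomp Require Import boolp classical_sets reals convex.

Set Implicit Arguments.
Unset Strict Implicit.
Unset Printing Implicit Defensive.

Import Order.TTheory GRing.Theory Num.Theory.

Local Open Scope classical_set_scope.
Local Open Scope ring_scope.

(* [jdot] is an arbitrary associative inner product, chosen once and for all as
   part of the structure. *)
HB.mixin Record isEuclideanJordan (R : realType) E of Vector R E := {
  jmul : {bilinear E -> E -> E};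
  jone : E;
  jdot : {dot E for (@idfun R)};
  jmulC : forall x y : E, jmul x y = jmul y x;
  jmul_jordan : forall x y : E,
    jmul x (jmul (jmul x x) y) = jmul (jmul x x) (jmul x y);
  jmul1x : forall x : E, jmul jone x = x;
  jdotA : forall x y z : E, jdot (jmul x y) z = jdot x (jmul y z)
}.

#[short(type="ejaType")]
HB.structure Definition EuclideanJordan (R : realType) :=
  {E of isEuclideanJordan R E & Vector R E}.

Section EuclideanJordanTheory.
Variables (R : realType) (E : ejaType R).
Implicit Types (c x : E) (U W : {vspace E}).

Definition idempotent_elt c := jmul c c = c.

Definition primitive_idempotent c :=
  [/\ c != 0, idempotent_elt c &
      ~ exists a b : E, [/\ a != 0, b != 0, idempotent_elt a,
                            idempotent_elt b & c = a + b]].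

(* The family [c] is automatically injective: a nonzero idempotent is not
   orthogonal to itself. *)
Definition jordan_frame (r : nat) (c : 'I_r -> E) :=
  [/\ forall i, primitive_idempotent (c i),
      forall i j, i != j -> jmul (c i) (c j) = 0 &
      \sum_(i < r) c i = jone].

Definition has_rank (r : nat) := exists c : 'I_r -> E, jordan_frame c.

Definition square_cone : set E := [set x | exists y : E, x = jmul y y].

Definition subalgebra U := {in U &, forall x y, jmul x y \in U}.

Definition orthogonal_subalgebras U W :=
  {in U & W, forall x y, jmul x y = 0}.

Definition simple_eja :=
  {:E}%VS <> 0%VS /\
  ~ exists U W : {vspace E},
      [/\ subalgebra U /\ subalgebra W,
          U <> 0%VS /\ W <> 0%VS,
          orthogonal_subalgebras U W,
          (U + W)%VS = fullv & directv (U + W)].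

End EuclideanJordanTheory.

Arguments has_rank {R} E r.
Arguments square_cone {R} E.
Arguments simple_eja {R} E.

Section SelfAdjoint.
Variables (R : realType) (V : vectType R) (dot : {dot V for (@idfun R)}).

Definition self_adjoint : set 'End(V) :=
  [set f | forall x y : V, dot (f x) y = dot x (f y)].

Definition tensor_square (x : V) : 'End(V) :=
  linfun (fun y : V => dot x y *: x).

Definition completely_positive (K : set V) : set 'End(V) :=
  [set f | exists (k : nat) (a : 'I_k -> V),
     [/\ (0 < k)%N, forall i, K (a i) & f = \sum_(i < k) tensor_square (a i)]].

(* The trace does not depend on the basis.  On self-adjoint maps [trace_form] is
   the inner product induced by [dot]. *)
Definition trace_form (f g : 'End(V)) : R :=
  let e := vbasis {:V} in \tr (passmx.mxof e e (f \o g)%VF).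

End SelfAdjoint.

Arguments trace_form {R V} f g.

(* Here the ambient inner product space is the subspace [S] of [V], with inner
   product the restriction of [form] to [S]. *)
Section Faces.
Variables (R : realType) (V : lmodType R).
Variables (S : set V) (form : V -> V -> R).
Implicit Types (C F : set V).

Definition is_cone C := forall (a : R) (x : V), 0 <= a -> C x -> C (a *: x).

Definition is_face C F :=
  [/\ F !=set0, convex_set F, is_cone F, F `<=` C &
      forall a b : V, C a -> C b -> F (a + b) -> F a /\ F b].

Definition dual_cone C : set V :=
  [set y | S y /\ forall x, C x -> 0 <= form x y].

Definition is_exposed_face C F :=
  exists2 d, dual_cone C d & F = C `&` [set x | form x d = 0].

Definition facially_exposed C := forall F, is_face C F -> is_exposed_face C F.

End Faces.

(* Main.v *)
From HB Require Import structures.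
Require Import Defs.
From mathcomp Require Import all_boot all_order all_algebra.
From mathcomp Require Import boolp classical_sets reals convex.
From mathcomp Require Import unstable interval_inference.
From mathcomp Require Import complex.
From mathcomp Require Import ring lra.

(** Completely positive cones are studied through the dual cone: a self-adjoint
    operator pairs with the square [a (x) a] as its quadratic form at [a]
    ([trace_form_tensor_square]), so the dual of [CP(K)] consists of the forms
    that are nonnegative on [K]. A face is exposed when some such form vanishes
    on it and on no other square.

    Let [c1], [c2], [c3] be a Jordan frame, and join [ci] to [cj] when the
    Peirce space [E_ij], where both act as [1/2], is nonzero. Each [E_ii] is the
    line of [ci] ([primitive_peirce1]): an element of [E_ii] has an eigenvector
    among its own polynomials, some multiple of which is an idempotent below
    [ci]. If the algebra splits, some [ci] is isolated; if it is simple, no [ci]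
    is, and the frame contains a path of two edges.

    If [c1] is isolated, [E] is the orthogonal sum of the line of [c1] and of a
    spin factor, and the cone of squares is the product of a half-line and a
    Lorentz cone [{x | Q x >= 0, <x, e> >= 0}] ([split_square_cone]). For such a
    product, [CP] has an exact description
    ([completely_positive_lorentz_product]): a positive semidefinite [f] belongs
    to it as soon as [f] pairs nonnegatively with [Q] and the row [f c1] lies in
    the Lorentz cone. One decomposes [f] into one square that carries the whole
    coordinate along [c1] and squares of vectors without such a coordinate, and
    rotates pairs of vectors until all lie in the product, up to sign.
    So [CP] is an intersection of three cones each of which is visibly facially
    exposed, and the sum of the three exposing forms exposes the face
    ([lorentz_product_facially_exposed]).

    If the frame contains the path 1-2-3, normalized elements [u] of [E_12] and
    [v] of [E_23] generate with the frame a copy of the real symmetric 3 by 3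
    matrices ([connected_symmetric_frame]). The elements [1], [A = c1 - c3] and
    [B = (u + v) / sqrt 2] span a space that meets the cone of squares in a
    round cone [x^2 >= y^2 + z^2] ([lor_square_cone]), so the elements of [CP]
    supported on this space at which the Lorentz form vanishes form a face
    ([lor_face_is_face]). A form [d] nonnegative on squares that vanishes at the
    four boundary points [1 +- A] and [1 +- B] of this cone vanishes at [1],
    which is interior, so this face is not exposed ([lor_face_not_exposed]).
    Indeed [d(p, .)] is nonnegative on squares and annihilates [p], for each of
    the four points [p]. So [d(1 +- A, .)] vanishes at [c2], hence so does their
    sum [2 d(1, .)]. This is also the sum of [d(1 + B, .)] and [d(1 - B, .)],
    which therefore vanish at [c2] too. The points [1 + B] and [c2] together
    dominate a multiple of [1], and so do [1 - B] and [c2]; hence [d(1 +- B, .)]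
    vanish at [1], and their sum gives [d(1, 1) = 0]. *)

Set Implicit Arguments.
Unset Strict Implicit.
Unset Printing Implicit Defensive.

Import Order.TTheory GRing.Theory Num.Theory passmx.

Local Open Scope classical_set_scope.
Local Open Scope ring_scope.

(** * Inner products and rank-one operators *)

Section InnerProduct.
Variables (R : realType) (V : vectType R) (dot : {dot V for (@idfun R)}).
Implicit Types (x y z : V) (a : R).

Lemma dotC x y : dot x y = dot y x.
Proof. by rewrite (hermC dot x y) expr0 mul1r. Qed.

Lemma dotDl x y z : dot (x + y) z = dot x z + dot y z.
Proof. exact: linearDl. Qed.

Lemma dotDr x y z : dot x (y + z) = dot x y + dot x z.
Proof. exact: linearDr. Qed.

Lemma dotZl a x y : dot (a *: x) y = a * dot x y.
Proof. exact: linearZl_LR. Qed.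

Lemma dotZr a x y : dot x (a *: y) = a * dot x y.
Proof. exact: linearZr_LR. Qed.

Lemma dotNl x y : dot (- x) y = - dot x y.
Proof. exact: linearNl. Qed.

Lemma dotNr x y : dot x (- y) = - dot x y.
Proof. exact: linearNr. Qed.

Lemma dot0l x : dot 0 x = 0.
Proof. exact: linear0l. Qed.

Lemma dot0r x : dot x 0 = 0.
Proof. exact: linear0r. Qed.

Definition dotE := (dotDl, dotDr, dotZl, dotZr, dotNl, dotNr, dot0l, dot0r).

Lemma dot_suml I (r : seq I) (F : I -> V) y :
  dot (\sum_(i <- r) F i) y = \sum_(i <- r) dot (F i) y.
Proof. exact: linear_sumlz. Qed.

Lemma dot_sumr I (r : seq I) (F : I -> V) y :
  dot y (\sum_(i <- r) F i) = \sum_(i <- r) dot y (F i).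
Proof. exact: linear_sumr. Qed.

Lemma dot_gt0 x : x != 0 -> 0 < dot x x.
Proof. exact: neq0_dnorm_gt0. Qed.

Lemma dot_ge0 x : 0 <= dot x x.
Proof. by have [->|/dot_gt0/ltW//] := eqVneq x 0; rewrite dot0l. Qed.

Lemma dot_eq0 x : dot x x <= 0 -> x = 0.
Proof. by have [//|/dot_gt0 + xle] := eqVneq x 0; rewrite ltNge xle. Qed.

(** Testing against every vector turns an identity between vectors into an
    identity between reals, where the decision procedures for rings apply. *)
Lemma dot_inj x y : (forall z, dot x z = dot y z) -> x = y.
Proof.
move=> xy; apply/eqP; rewrite -subr_eq0; apply/eqP/dot_eq0.
by rewrite dotDl dotNl xy subrr.
Qed.

Lemma span_projection (s : seq V) y :
  exists2 p, p \in <<s>>%VS & forall v, v \in <<s>>%VS -> dot v (y - p) = 0.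
Proof.
elim: s y => [|b s IHs] y.
  exists 0; rewrite ?mem0v// => v; rewrite span_nil memv0 => /eqP ->.
  exact: dot0l.
have [p ps py] := IHs y; have [q qs qb] := IHs b.
pose r := b - q.
have rs v : v \in <<s>>%VS -> dot v r = 0 by apply: qb.
(* When [r] vanishes, [b] lies in the span already and the coefficient is 0. *)
pose k := dot r (y - p) / dot r r.
exists (p + k *: r).
  have -> : p + k *: r = k *: b + (p - k *: q) by rewrite scalerBr addrCA.
  by rewrite span_cons memv_add ?memvZ ?memv_line// memvB// memvZ.
move=> v; rewrite span_cons => /memv_addP[_ /vlineP[m ->] [w ws ->]].
have -> : m *: b + w = m *: r + (m *: q + w).
  by rewrite addrA -scalerDr subrK.
have mqw : m *: q + w \in <<s>>%VS by rewrite memvD// memvZ.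
rewrite (_ : y - (p + k *: r) = (y - p) - k *: r); last by rewrite opprD addrA.
rewrite dotDl !(dotDr _ (y - p)) (py _ mqw) !dotNr !dotZr (rs _ mqw) mulr0
  !dotZl oppr0.
rewrite !addr0 /k.
have [->|r0] := eqVneq r 0; first by rewrite !dot0l; ring.
by field; rewrite gt_eqF// dot_gt0.
Qed.

(** What remains of [x] after projection onto the span is orthogonal to the
    span, hence to [x] and to itself. *)
Lemma mem_span_orthogonal (s : seq V) x :
  (forall y, {in s, forall v, dot v y = 0} -> dot y x = 0) -> x \in <<s>>%VS.
Proof.
move=> sx; have [p ps px] := span_projection s x.
suff /subr0_eq -> : x - p = 0 by [].
apply/dot_eq0; rewrite dotDr dotNr (dotC _ p) px// subr0 sx// => v vs.
exact: px (memv_span vs).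
Qed.

Local Notation ts := (tensor_square dot).

Lemma tensor_squareE x y : ts x y = dot x y *: x.
Proof.
have lin : linear (fun z => dot x z *: x).
  by move=> a u v; rewrite !dotE scalerDl scalerA.
pose f : {linear V -> V} :=
  HB.pack (fun z => dot x z *: x) (GRing.isLinear.Build _ _ _ _ _ lin).
by rewrite /tensor_square (lfunE f).
Qed.

Lemma tensor_square0 : ts 0 = 0.
Proof. by apply/lfunP => y; rewrite tensor_squareE zero_lfunE scaler0. Qed.

Lemma tensor_squareZ a x : ts (a *: x) = a ^+ 2 *: ts x.
Proof.
apply/lfunP => y; rewrite scale_lfunE !tensor_squareE dotZl !scalerA.
by congr (_ *: _); ring.
Qed.

Lemma tensor_squareN x : ts (- x) = ts x.
Proof. by rewrite -scaleN1r tensor_squareZ sqrrN expr1n scale1r. Qed.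

Lemma tensor_square_self_adjoint x : self_adjoint dot (ts x).
Proof.
by move=> y z; rewrite !tensor_squareE !dotE (dotC y x) mulrC.
Qed.

Lemma self_adjoint_sum I (r : seq I) (F : I -> 'End(V)) :
  (forall i, self_adjoint dot (F i)) -> self_adjoint dot (\sum_(i <- r) F i).
Proof.
move=> sa; elim: r => [|i r IHr] y z.
  by rewrite big_nil !zero_lfunE dot0l dot0r.
by rewrite big_cons !add_lfunE !dotE IHr (sa i y z).
Qed.

Lemma trace_formDl (f g h : 'End(V)) :
  trace_form (f + g) h = trace_form f h + trace_form g h.
Proof. by rewrite /trace_form /= comp_lfunDl !linearD. Qed.

Lemma trace_formDr (f g h : 'End(V)) :
  trace_form f (g + h) = trace_form f g + trace_form f h.
Proof. by rewrite /trace_form /= comp_lfunDr !linearD. Qed.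

Lemma trace_formZl a (f g : 'End(V)) :
  trace_form (a *: f) g = a * trace_form f g.
Proof. by rewrite /trace_form /= -comp_lfunZl !linearZ. Qed.

Lemma trace_form0l (g : 'End(V)) : trace_form 0 g = 0.
Proof. by rewrite -(scale0r 0) trace_formZl mul0r. Qed.

Lemma trace_form0r (f : 'End(V)) : trace_form f 0 = 0.
Proof. by apply: (addrI (trace_form f 0)); rewrite -trace_formDr !addr0. Qed.

Lemma trace_form_suml I (r : seq I) (F : I -> 'End(V)) (g : 'End(V)) :
  trace_form (\sum_(i <- r) F i) g = \sum_(i <- r) trace_form (F i) g.
Proof.
elim: r => [|i r IHr]; first by rewrite !big_nil trace_form0l.
by rewrite !big_cons trace_formDl IHr.
Qed.

(** Pairing with a rank-one operator evaluates the quadratic form: this is what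
    makes the dual of the completely positive cone the copositive cone. *)
Lemma trace_form_tensor_square x (g : 'End(V)) :
  trace_form (ts x) g = dot x (g x).
Proof.
rewrite /trace_form /mxtrace; set e := vbasis _.
transitivity (dot x (g (\sum_i coord e i x *: e`_i))); last first.
  by rewrite -coord_vbasis ?memvf.
rewrite linear_sum dot_sumr; apply: eq_bigr => i _.
rewrite mxE /= vecof_delta mxE comp_lfunE tensor_squareE !linearZ/=.
exact: mulrC.
Qed.
End InnerProduct.

(** * Faces of completely positive cones *)

Lemma psumr_seq_eq0 (R : realType) (T : eqType) (s : seq T) (g : T -> R) :
  {in s, forall x, 0 <= g x} -> \sum_(x <- s) g x = 0 ->
  {in s, forall x, g x = 0}.
Proof.
elim: s => [//|y s IHs] g0.
have gy : 0 <= g y by rewrite g0 ?mem_head.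
have gs : {in s, forall x, 0 <= g x} by move=> z zs; rewrite g0// inE zs orbT.
have sum0 : 0 <= \sum_(x <- s) g x by rewrite big_seq sumr_ge0.
rewrite big_cons => /eqP; rewrite paddr_eq0// => /andP[/eqP gy0 /eqP s0] x.
by rewrite inE => /predU1P[->//|]; apply: IHs.
Qed.

Section ConvexCones.
Variables (R : realType) (V : lmodType R).
Implicit Types (C F : set V) (x y : V).

Lemma cone_convex C : (forall x y, C x -> C y -> C (x + y)) -> is_cone C ->
  convex_set C.
Proof.
move=> CD CZ x y l; rewrite !inE => Cx Cy; apply: CD; apply: CZ => //.
exact: onem_ge0.
Qed.

Lemma face0 C F : is_face C F -> F 0.
Proof. by move=> [[x Fx] _ FZ _ _]; rewrite -(scale0r x); apply: FZ. Qed.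

Lemma faceD C F x y : is_face C F -> F x -> F y -> F (x + y).
Proof.
move=> [_ cF FZ _ _] Fx Fy.
have h0 : 0 <= 2^-1 :> R by lra.
have h1 : 2^-1 <= 1 :> R by lra.
pose h := Itv01 h0 h1.
have := cF x y h; rewrite !inE => /(_ Fx Fy) /(FZ 2 _ (ler0n _ 2)).
rewrite /conv /= scalerDr !scalerA divff// scale1r.
by rewrite (_ : 2 * _ = 1) ?scale1r// /onem; field.
Qed.

Lemma face_sum C F (I : eqType) (r : seq I) (G : I -> V) : is_face C F ->
  (forall i, i \in r -> F (G i)) -> F (\sum_(i <- r) G i).
Proof.
move=> fF; elim: r => [|i r IHr] FG; first by rewrite big_nil;
  apply: (face0 fF).
rewrite big_cons; apply: (faceD fF); first by apply: FG; rewrite mem_head.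
by apply: IHr => j jr; apply: FG; rewrite inE jr orbT.
Qed.
End ConvexCones.

Section CompletelyPositive.
Variables (R : realType) (V : vectType R) (dot : {dot V for (@idfun R)}).
Variables (K : set V) (K0 : K 0) (KZ : is_cone K).
Implicit Types (a x y : V) (d f g : 'End(V)) (F : set 'End(V)).

Local Notation ts := (tensor_square dot).
Local Notation CP := (completely_positive dot K).
Local Notation dualCP := (dual_cone (self_adjoint dot) trace_form CP).

Lemma completely_positiveP f : CP f <->
  exists2 s : seq V, (forall a, a \in s -> K a) & f = \sum_(a <- s) ts a.
Proof.
split=> [[k [a [k0 Ka ->]]]|[s Ks ->]].
  exists (map a (enum 'I_k)); first by move=> _ /mapP[i _ ->].
  by rewrite big_map big_enum.
exists (size s).+1, (fun i => nth 0 (0 :: s) i); split=> // [[[|i] /= si]|].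
- by [].
- by apply: Ks; rewrite mem_nth.
by rewrite big_ord_recl /= tensor_square0 add0r (big_nth 0) big_mkord.
Qed.

Lemma completely_positive_tensor a : K a -> CP (ts a).
Proof.
move=> Ka; apply/completely_positiveP; exists [:: a]; last by rewrite big_seq1.
by move=> b; rewrite inE => /eqP ->.
Qed.

Lemma completely_positive0 : CP 0.
Proof. by rewrite -(tensor_square0 dot); apply: completely_positive_tensor. Qed.

Lemma completely_positiveD f g : CP f -> CP g -> CP (f + g).
Proof.
move=> /completely_positiveP[s Ks ->] /completely_positiveP[t Kt ->].
apply/completely_positiveP; exists (s ++ t); last by rewrite big_cat.
by move=> a; rewrite mem_cat => /orP[/Ks|/Kt].
Qed.

Lemma completely_positiveZ k f : 0 <= k -> CP f -> CP (k *: f).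
Proof.
move=> k0 /completely_positiveP[s Ks ->]; apply/completely_positiveP.
exists [seq Num.sqrt k *: a | a <- s].
  by move=> _ /mapP[a /Ks Ka ->]; apply: KZ => //; exact: sqrtr_ge0.
rewrite big_map scaler_sumr; apply: eq_bigr => a _.
by rewrite tensor_squareZ sqr_sqrtr.
Qed.

Lemma completely_positive_sum (s : seq V) :
  (forall a, a \in s -> K a) -> CP (\sum_(a <- s) ts a).
Proof. by move=> Ks; apply/completely_positiveP; exists s. Qed.

Lemma dual_completely_positiveP d : dualCP d <->
  self_adjoint dot d /\ forall a, K a -> 0 <= dot a (d a).
Proof.
split=> -[sd pd]; split=> //.
  move=> a Ka.
  by rewrite -trace_form_tensor_square; apply/pd/completely_positive_tensor.
move=> f /completely_positiveP[s Ks ->].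
rewrite trace_form_suml big_seq sumr_ge0// => a /Ks Ka.
by rewrite trace_form_tensor_square pd.
Qed.

(** First-order condition at a zero [a] of a copositive form: moving from [a]
    towards a point of the cone cannot decrease the form. *)
Lemma copositive_zero_ge0 d a x : (forall x y, K x -> K y -> K (x + y)) ->
  dualCP d -> K a -> K x -> dot a (d a) = 0 -> 0 <= dot x (d a).
Proof.
move=> KD /dual_completely_positiveP[sd pd] Ka Kx a0.
set m := dot x (d a); set M := dot x (d x).
have M0 : 0 <= M by apply: pd.
rewrite leNgt; apply/negP => m0.
have eps0 : 0 <= - m / (M + 1) by rewrite divr_ge0; lra.
set eps := - m / (M + 1) in eps0.
have epsE : eps * (M + 1) = - m by rewrite mulfVK//; lra.
have := pd _ (KD _ _ Ka (KZ eps0 Kx)).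
rewrite linearD linearZ /= !dotE a0 -(sd a x) (dotC dot (d a)) -/m -/M.
have : 0 < eps by rewrite divr_gt0; lra.
nra.
Qed.

(** A sum over a finite subset of [F] that spans the same space as [F] is a
    point of the relative interior of [F]. *)
Lemma face_interior_point F : is_face CP F -> exists2 f, F f &
  forall d, dualCP d -> trace_form f d = 0 -> forall g, F g -> trace_form g d =
    0.
Proof.
move=> fF; have [_ _ _ FC _] := fF.
pose P n := `[< exists2 s : seq 'End(V), (forall f, f \in s -> F f)
                                   & \dim <<s>> = n >].
have exP : exists n, P n by exists (\dim <<nil : seq 'End(V)>>); apply/asboolP;
  exists nil.
have Pub n : P n -> (n <= \dim {:'End(V)})%N.
  by move=> /asboolP[s _ <-]; rewrite dimvS// subvf.
case: (ex_maxnP exP Pub) => _ /asboolP[s Fs <-] maxs.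
exists (\sum_(f <- s) f); first exact: (face_sum fF).
move=> d [_ pd]; rewrite trace_form_suml => s0 g Fg.
have {}s0 : {in s, forall f, trace_form f d = 0}.
  apply: psumr_seq_eq0 => // f fs.
  by apply/pd/FC/Fs.
have gs : g \in <<s>>%VS.
  have : (\dim <<g :: s>> <= \dim <<s>>)%N.
    apply: maxs; apply/asboolP; exists (g :: s) => // f.
    by rewrite inE => /predU1P[->//|/Fs].
  rewrite span_cons => ds.
  have /eqP -> : (<<s>> == <[g]> + <<s>>)%VS by rewrite eqEdim addvSr.
  by rewrite (subvP (addvSl _ _)) ?memv_line.
rewrite (coord_span (X := in_tuple s) gs).
rewrite trace_form_suml big1// => i _.
by rewrite trace_formZl s0 ?mulr0// mem_nth.
Qed.

(** If some form exposes [f] in [CP] so tightly that the squares at which it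
    vanishes can be subtracted from [f], then these squares lie in the minimal
    face of [f]. *)
Lemma completely_positive_facially_exposed :
  (forall f, CP f -> exists d, [/\ dualCP d, trace_form f d = 0 &
     forall a, K a -> dot a (d a) = 0 ->
     exists2 eps, 0 < eps & CP (f - eps *: ts a)]) ->
  facially_exposed (self_adjoint dot) trace_form CP.
Proof.
move=> expose F fF; have [f Ff intf] := face_interior_point fF.
have [_ _ FZ FC FD] := fF.
have [d [dd fd sub]] := expose f (FC f Ff).
have [_ pd] := (dual_completely_positiveP d).1 dd.
exists d => //; apply/seteqP; split=> g; first by move=> Fg; split;
  [exact: FC|exact: intf].
move=> [/completely_positiveP[s Ks ->]] /=.
rewrite trace_form_suml => s0.
have {}s0 : {in s, forall a, dot a (d a) = 0}.
  apply: psumr_seq_eq0 => [a /Ks/pd//|].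
  by rewrite -[RHS]s0; apply: eq_bigr => a _; rewrite trace_form_tensor_square.
apply: (face_sum fF) => a sa.
have [eps eps0 Cf] := sub a (Ks a sa) (s0 a sa).
have Ce : CP (eps *: ts a).
  by apply: completely_positiveZ;
    [exact: ltW|exact/completely_positive_tensor/Ks].
have [|_ Fa] := FD _ _ Cf Ce; first by rewrite subrK.
rewrite -(scale1r (ts a)) -(mulVf (lt0r_neq0 eps0)) -scalerA.
by apply: FZ => //; rewrite invr_ge0 ltW.
Qed.
End CompletelyPositive.

(** * Peirce calculus *)

Reserved Notation "x ** y" (at level 40, left associativity).
Reserved Notation "''<' x , y >"
  (at level 2, x, y at level 65, format "''<' x ,  y >").

Section Peirce.
Variables (R : realType) (E : ejaType R).
Implicit Types (a b k : R) (c e u v w x y z : E).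

Local Notation "x ** y" := (jmul x y).
Local Notation "''<' x , y >" := (jdot x y).

Lemma jmulDl x y z : (x + y) ** z = x ** z + y ** z.
Proof. exact: linearDl. Qed.

Lemma jmulDr x y z : x ** (y + z) = x ** y + x ** z.
Proof. exact: linearDr. Qed.

Lemma jmulZl a x y : (a *: x) ** y = a *: (x ** y).
Proof. exact: linearZl_LR. Qed.

Lemma jmulZr a x y : x ** (a *: y) = a *: (x ** y).
Proof. exact: linearZr_LR. Qed.

Lemma jmulNl x y : (- x) ** y = - (x ** y).
Proof. exact: linearNl. Qed.

Lemma jmulNr x y : x ** (- y) = - (x ** y).
Proof. exact: linearNr. Qed.

Lemma jmul0l x : 0 ** x = 0.
Proof. exact: linear0l. Qed.

Lemma jmul0r x : x ** 0 = 0.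
Proof. exact: linear0r. Qed.

Definition jmulE :=
  (jmulDl, jmulDr, jmulZl, jmulZr, jmulNl, jmulNr, jmul0l, jmul0r).

(** The Jordan identity is cubic in [x]. For [x + t z], the part of degree
    one in [z] is isolated by the values [t = 1] and [t = -1] and by the
    identity for [z] alone. *)
Lemma jordan_linearized x y z :
  z ** ((x ** x) ** y) + 2 *: (x ** ((x ** z) ** y)) =
  2 *: ((x ** z) ** (x ** y)) + (x ** x) ** (z ** y).
Proof.
have sq k : (x + k *: z) ** (x + k *: z) =
    x ** x + (2 * k) *: (x ** z) + k ^+ 2 *: (z ** z).
  rewrite !jmulE (jmulC z x); apply: (dot_inj (dot := jdot)) => t.
  by rewrite !dotE; ring.
apply: (dot_inj (dot := jdot)) => t.
have J k := congr1 (jdot^~ t) (jmul_jordan (x + k *: z) y).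
move: (J 1) (J (-1)) (congr1 (jdot^~ t) (jmul_jordan z y)).
by rewrite !sq !jmulDl !jmulDr !jmulZl !jmulZr !dotDl !dotZl; lra.
Qed.

(** Applied to [z], the full polarization of the Jordan identity expresses the
    multiplication by a product through multiplications by its factors. *)
Lemma jordan_polarized x y w z :
  ((x ** w) ** y) ** z =
  (w ** y) ** (x ** z) + (x ** y) ** (w ** z) + (x ** w) ** (y ** z)
  - x ** (y ** (w ** z)) - w ** (y ** (x ** z)).
Proof.
apply: (dot_inj (dot := jdot)) => t.
have /(congr1 (jdot^~ t)) := jordan_linearized (x + w) y z.
have /(congr1 (jdot^~ t)) := jordan_linearized x y z.
have /(congr1 (jdot^~ t)) := jordan_linearized w y z.
rewrite !jmulE !dotE (jmulC w x) (jmulC z ((x ** w) ** y)).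
rewrite (jmulC (w ** z) y) (jmulC (x ** z) y) (jmulC z y).
rewrite (jmulC (w ** y) (x ** z)) (jmulC (x ** y)).
lra.
Qed.

Section Idempotent.
Variables (c : E) (cc : idempotent_elt c).

Lemma peirce_cubic v :
  2 *: (c ** (c ** (c ** v))) + c ** v = 3 *: (c ** (c ** v)).
Proof.
apply: (dot_inj (dot := jdot)) => t.
have /(congr1 (jdot^~ t)) := jordan_linearized c c v.
by rewrite !cc (jmulC v c) (jmulC (c ** v) c) !dotE; lra.
Qed.

Definition peirce1 v := 2 *: (c ** (c ** v)) - c ** v.
Definition peirce_half v := 4 *: (c ** v - c ** (c ** v)).
Definition peirce0 v := v - 3 *: (c ** v) + 2 *: (c ** (c ** v)).

Lemma peirce_decomposition v : v = peirce1 v + peirce_half v + peirce0 v.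
Proof.
by apply: (dot_inj (dot := jdot)) => t;
  rewrite /peirce1 /peirce_half /peirce0 !dotE; lra.
Qed.

Lemma peirce1P v : c ** peirce1 v = peirce1 v.
Proof.
apply: (dot_inj (dot := jdot)) => t.
have /(congr1 (jdot^~ t)) := peirce_cubic v.
by rewrite /peirce1 !jmulE !dotE; lra.
Qed.

Lemma peirce_halfP v : c ** peirce_half v = 2^-1 *: peirce_half v.
Proof.
apply: (dot_inj (dot := jdot)) => t.
have /(congr1 (jdot^~ t)) := peirce_cubic v.
by rewrite /peirce_half !jmulE !dotE; lra.
Qed.

Lemma peirce0P v : c ** peirce0 v = 0.
Proof.
apply: (dot_inj (dot := jdot)) => t.
have /(congr1 (jdot^~ t)) := peirce_cubic v.
by rewrite /peirce0 !jmulE !dotE; lra.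
Qed.

Lemma peirce1_commutes z y : c ** z = z -> c ** (z ** y) = z ** (c ** y).
Proof.
move=> cz; apply: (dot_inj (dot := jdot)) => t.
have /(congr1 (jdot^~ t)) := jordan_linearized c y z.
by rewrite cc cz !dotE; lra.
Qed.

Lemma peirce0_commutes z y : c ** z = 0 -> c ** (z ** y) = z ** (c ** y).
Proof.
move=> cz; apply: (dot_inj (dot := jdot)) => t.
have /(congr1 (jdot^~ t)) := jordan_linearized c y z.
by rewrite cc cz !jmulE !dotE; lra.
Qed.

Lemma peirce10_orthogonal z y : c ** z = z -> c ** y = 0 -> z ** y = 0.
Proof.
move=> cz cy; have := peirce0_commutes z cy.
by rewrite cz (jmulC y) (peirce1_commutes _ cz) cy jmul0r.
Qed.

Lemma peirce_half_square u : c ** u = 2^-1 *: u ->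
  c ** (c ** (u ** u)) = c ** (u ** u).
Proof.
move=> cu; apply: (dot_inj (dot := jdot)) => t.
have /(congr1 (jdot^~ t)) := jordan_linearized u c c.
rewrite (jmulC u c) cu !jmulE (jmulC u c) cu cc (jmulC (u ** u) c).
by rewrite !jmulE !dotE; lra.
Qed.

(** Multiplication by an idempotent has eigenvalues 0, 1/2 and 1, so it is a
    sum of squares of self-adjoint operators. *)
Lemma idempotent_psd v : 0 <= '<v, c ** v>.
Proof.
have sa x y : '<c ** x, y> = '<x, c ** y> by rewrite jmulC jdotA.
suff -> : '<v, c ** v> = 2^-1 * '<peirce_half v, peirce_half v>
                         + '<peirce1 v, peirce1 v>.
  by rewrite addr_ge0 ?mulr_ge0 ?dot_ge0// invr_ge0.
have h1 p : c ** p = p -> '<peirce1 v, p> = '<v, p>.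
  by move=> cp; rewrite /peirce1 !dotE !sa !cp; lra.
have h2 p : c ** p = 2^-1 *: p -> '<peirce_half v, p> = '<v, p>.
  by move=> cp; rewrite /peirce_half !dotE !sa !(cp, jmulZr, dotZr); lra.
rewrite h1 ?peirce1P// h2 ?peirce_halfP//.
by rewrite /peirce1 /peirce_half !dotE; lra.
Qed.
End Idempotent.
End Peirce.

(** * The Peirce space of a primitive idempotent is a line *)

Lemma real_poly_factor (R : realType) (p : {poly R}) : (1 < size p)%N ->
  (exists a q, p = q * ('X - a%:P)) \/
  (exists a b q, b != 0 /\ p = q * (('X - a%:P) ^+ 2 + (b ^+ 2)%:P)).
Proof.
pose toC : {rmorphism R -> complex R} := real_complex R.
move=> p1; have [|z] := @closed_rootP _ (map_poly toC p) _.
  by rewrite size_map_poly gtn_eqF.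
case: z => a b rz.
have [b0|b0] := eqVneq b 0; [left|right].
  have /factor_theorem[q ->] : root p a; last by exists a, q.
  by rewrite -(fmorph_root toC) -[toC a]/(Complex a 0) -b0.
exists a, b; pose d : {poly R} := ('X - a%:P) ^+ 2 + (b ^+ 2)%:P.
have dm : d \is monic.
  rewrite monicE lead_coefDl ?lead_coef_exp ?lead_coefXsubC ?expr1n//.
  by rewrite size_exp_XsubC (leq_ltn_trans (size_polyC_leq1 _)).
have dz : (map_poly toC d).[Complex a b] = 0.
  rewrite /d rmorphD rmorphXn rmorphB /= map_polyX !map_polyC !hornerE /=.
  apply/eqP; rewrite eq_complex /=; apply/andP; split; apply/eqP; ring.
have sd : size d = 3%N.
  rewrite /d size_polyDl ?size_exp_XsubC//.
  by rewrite (leq_ltn_trans (size_polyC_leq1 _)).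
exists (divp p d); split=> //.
pose r := modp p d.
have r2 : (size r <= 2)%N by rewrite -ltnS -sd ltn_modp monic_neq0.
have rE : r = (r`_1)%:P * 'X + (r`_0)%:P.
  by apply/polyP => -[|[|i]];
    rewrite coefD coefMX !coefC ?addr0 ?add0r//= nth_default// (leq_trans r2).
have rz0 : (map_poly toC r).[Complex a b] = 0.
  move: rz; rewrite rootE {1}(divp_eq p d) rmorphD rmorphM hornerD hornerM dz.
  by rewrite mulr0 add0r => /eqP.
have [ra] : r`_1 * a + r`_0 = 0 /\ r`_1 * b = 0.
  move: rz0; rewrite {1}rE rmorphD rmorphM /= map_polyX !map_polyC !hornerE /=.
  by simpc; case.
move/eqP; rewrite mulf_eq0 (negPf b0) orbF => /eqP r1;
  rewrite r1 mul0r add0r in ra.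
by rewrite {1}(divp_eq p d) -/r rE r1 ra mul0r !addr0.
Qed.

Section PrimitiveIdempotent.
Variables (R : realType) (E : ejaType R).
Implicit Types (a b k : R) (c e u v w x y z : E) (p q : {poly R}).

Local Notation "x ** y" := (jmul x y).
Local Notation "''<' x , y >" := (jdot x y).

Section Powers.
Variables (c x : E) (cc : idempotent_elt c) (cx : c ** x = x).

(** The powers of [x] in the Peirce space of [c], whose unit is [c]. *)
Definition jpow n := iter n (jmul x) c.

Lemma jpow1 : jpow 1 = x. Proof. by rewrite /jpow /= jmulC. Qed.

Lemma jpowS n : jpow n.+1 = x ** jpow n. Proof. by []. Qed.

Lemma jpow_mul_rec n z : jpow n.+2 ** z =
  2 *: (jpow n.+1 ** (x ** z)) + (x ** x) ** (jpow n ** z)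
  - x ** (x ** (jpow n ** z)) - jpow n ** (x ** (x ** z)).
Proof.
rewrite !jpowS (jmulC x (x ** _)) jordan_polarized.
apply: (dot_inj (dot := jdot)) => t.
by rewrite (jmulC (jpow n) x) !dotE; ring.
Qed.

(** Multiplications by powers satisfy a two-step recursion in the commuting
    multiplications by [x] and by its square. *)
Lemma jpow_commutes n z :
  x ** (jpow n ** z) = jpow n ** (x ** z) /\
  (x ** x) ** (jpow n ** z) = jpow n ** ((x ** x) ** z).
Proof.
have c2 : c ** (x ** x) = x ** x.
  by rewrite (peirce1_commutes cc _ cx) cx.
elim/ltn_ind: n z => -[|[|n]] IHn z.
- by rewrite /= (peirce1_commutes cc _ cx) (peirce1_commutes cc _ c2).
- by rewrite jpow1 jmul_jordan.
have [h1 h1'] : (forall y, x ** (jpow n.+1 ** y) = jpow n.+1 ** (x ** y)) /\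
   (forall y, (x ** x) ** (jpow n.+1 ** y) = jpow n.+1 ** ((x ** x) ** y)).
  by split=> y; have [] := IHn n.+1 (ltnSn _) y.
have [h h'] : (forall y, x ** (jpow n ** y) = jpow n ** (x ** y)) /\
   (forall y, (x ** x) ** (jpow n ** y) = jpow n ** ((x ** x) ** y)).
  by split=> y; have [] := IHn n (ltnW (ltnSn _)) y.
by split; rewrite !jpow_mul_rec !jmulE !(h1, h1', h, h', jmul_jordan).
Qed.

Definition jeval p := \sum_(i < size p) p`_i *: jpow i.

Lemma jevalE n p : (size p <= n)%N -> jeval p = \sum_(i < n) p`_i *: jpow i.
Proof.
move=> pn; rewrite /jeval (big_ord_widen n (fun i => p`_i *: jpow i) pn).
rewrite big_mkcond; apply: eq_bigr => i _; case: ltnP => // /(nth_default 0) ->.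
by rewrite scale0r.
Qed.

Lemma jevalD p q : jeval (p + q) = jeval p + jeval q.
Proof.
set n := maxn (size p) (size q).
rewrite !(@jevalE n) ?leq_maxl ?leq_maxr ?size_polyD// -big_split/=.
by apply: eq_bigr => i _; rewrite coefD scalerDl.
Qed.

Lemma jevalZ k p : jeval (k *: p) = k *: jeval p.
Proof.
rewrite (jevalE (size_scale_leq _ _)) scaler_sumr.
by apply: eq_bigr => i _; rewrite coefZ scalerA.
Qed.

Lemma jevalMX p : jeval (p * 'X) = x ** jeval p.
Proof.
rewrite (@jevalE (size p).+1); last first.
  by rewrite (leq_trans (size_polyMleq _ _))// size_polyX addn2.
rewrite big_ord_recl coefMX eqxx scale0r add0r linear_sumr.
by apply: eq_bigr => i _; rewrite coefMX jmulZr.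
Qed.

Lemma jeval_commutes p z : x ** (jeval p ** z) = jeval p ** (x ** z).
Proof.
rewrite !linear_sumlz linear_sumr; apply: eq_bigr => i _.
by rewrite !jmulE; have [->] := jpow_commutes i z.
Qed.

Lemma jevalM_Xsub a p : jeval (p * ('X - a%:P)) = x ** jeval p - a *: jeval p.
Proof.
rewrite mulrBr (mulrC p a%:P) mul_polyC jevalD jevalMX -scaleNr jevalZ.
by rewrite scaleNr.
Qed.

Lemma jevalC k : jeval k%:P = k *: c.
Proof.
rewrite (@jevalE 1) ?size_polyC_leq1// big_ord1 coefC eqxx//.
Qed.

Lemma exists_annihilator : exists2 p, p != 0 & jeval p = 0.
Proof.
pose n := (\dim {:E}).+1.
pose X := [tuple jpow i | i < n].
have : ~~ free X.
  apply/negP => /eqP; rewrite size_tuple => dX.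
  by have := dimvS (subvf <<X>>%VS); rewrite dX ltnn.
move/negP; apply: contra_notP => noP; apply/freeP => k Xk i.
have pk0 : jeval (\poly_(j < n) k (inord j)) = 0.
  rewrite (jevalE (size_poly _ _)) -[RHS]Xk; apply: eq_bigr => j _.
  by rewrite coef_poly ltn_ord inord_val nth_mktuple.
have [pk|pk] := eqVneq (\poly_(j < n) k (inord j)) 0.
  by have /polyP/(_ i) := pk; rewrite coef_poly ltn_ord inord_val coef0.
by case: noP; exists (\poly_(j < n) k (inord j)).
Qed.
Lemma unit_jpow n : c ** jpow n = jpow n.
Proof.
by elim: n => [//|n IHn]; rewrite jpowS (peirce1_commutes cc _ cx) IHn.
Qed.

Lemma jeval_unit p : c ** jeval p = jeval p.
Proof.
rewrite linear_sumr; apply: eq_bigr => i _; by rewrite jmulZr unit_jpow.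
Qed.

(** Self-adjointness of the multiplication by [x] excludes complex conjugate
    pairs of roots of a minimal annihilating polynomial. *)
Lemma exists_eigenvector : c != 0 ->
  exists a q, jeval q != 0 /\ x ** jeval q = a *: jeval q.
Proof.
move=> c0; pose P n := `[< exists p, [/\ p != 0, jeval p = 0 & size p = n] >].
have exP : exists n, P n.
  by have [p p0 ep] := exists_annihilator; exists (size p); apply/asboolP;
    exists p.
case: (ex_minnP exP) => _ /asboolP[p [p0 ep <-]] minp.
have min q : q != 0 -> (size q < size p)%N -> jeval q != 0.
  move=> q0; apply: contraTneq => eq0; rewrite -leqNgt minp//.
  by apply/asboolP; exists q.
have p1 : (1 < size p)%N.
  rewrite ltnNge; apply/negP => /size1_polyC pE.
  move: p0 ep; rewrite pE polyC_eq0 jevalC => k0 /eqP.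
  by rewrite scaler_eq0 (negPf k0) (negPf c0).
have [[a [q pE]]|[a [b [q [b0 pE]]]]] := real_poly_factor p1.
  exists a, q; split; last by apply/eqP; rewrite -subr_eq0 -jevalM_Xsub -pE ep.
  have q0 : q != 0 by apply: contraNneq p0; rewrite pE => ->; rewrite mul0r.
  by apply: min => //; rewrite pE size_Mmonic ?monicXsubC// size_XsubC addn2.
have q0 : q != 0 by apply: contraNneq p0; rewrite pE => ->; rewrite mul0r.
have sd : size (('X - a%:P) ^+ 2 + (b ^+ 2)%:P) = 3%N.
  by rewrite size_polyDl size_exp_XsubC// (leq_ltn_trans (size_polyC_leq1 _)).
have : jeval q != 0.
  apply: min => //; rewrite pE size_mul// -?size_poly_eq0 sd//.
  by rewrite addnS addn2.
move/(dot_gt0 jdot); rewrite ltNge => /negP[].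
have sa v z : '<x ** v, z> = '<v, x ** z> by rewrite jmulC jdotA.
have : x ** (x ** jeval q - a *: jeval q) - a *: (x ** jeval q - a *: jeval q)
       + (b ^+ 2) *: jeval q = 0.
  rewrite -!jevalM_Xsub -jevalZ -jevalD -ep pE; congr jeval.
  by rewrite -mul_polyC; ring.
move/(congr1 (jdot (jeval q))).
have := dot_ge0 jdot (x ** jeval q - a *: jeval q).
have b2 : 0 < b ^+ 2 by rewrite exprn_even_gt0.
rewrite !jmulE !dotE !sa => le0 eq0.
by rewrite -(ler_pM2l b2); lra.
Qed.

End Powers.

(** An eigenvector [y] of the multiplication by [x] among the polynomials in [x]
    satisfies [y ** y = k y], so that [y / k] is an idempotent. *)
Lemma exists_spectral_idempotent c x : c != 0 -> idempotent_elt c ->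
  c ** x = x -> exists a e,
  [/\ e != 0, idempotent_elt e, c ** e = e & x ** e = a *: e].
Proof.
move=> c0 cc cx; have [a [q [y0 xy]]] := exists_eigenvector x c0.
set y := jeval c x q in y0 xy.
have cy : c ** y = y by apply: jeval_unit.
have yk : y ** y = q.[a] *: y.
  rewrite {2}/y linear_sumr horner_coef scaler_suml; apply: eq_bigr => i _.
  rewrite jmulZr -scalerA; congr (_ *: _).
  elim: (val i) => [|n IHn]; first by rewrite scale1r jmulC.
  by rewrite jpowS -jeval_commutes// IHn jmulZr xy scalerA exprSr.
have k0 : q.[a] != 0.
  apply: contraNneq y0 => k0; apply/eqP/(dot_eq0 (dot := jdot)).
  by rewrite -{1}cy jdotA yk k0 scale0r dot0r.
exists a, (q.[a]^-1 *: y); split.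
- by rewrite scaler_eq0 invr_eq0 negb_or k0.
- by rewrite /idempotent_elt jmulZl jmulZr yk !scalerA mulfVK.
- by rewrite jmulZr cy.
- by rewrite jmulZr xy !scalerA mulrC.
Qed.

Lemma idempotentB c e : idempotent_elt c -> idempotent_elt e -> c ** e = e ->
  idempotent_elt (c - e).
Proof.
move=> cc ee ce.
rewrite /idempotent_elt jmulDl !jmulDr !jmulNl !jmulNr cc ee (jmulC e c) ce.
by rewrite (subrr (- e)) addr0.
Qed.

Lemma primitive_peirce1 c x : primitive_idempotent c -> c ** x = x ->
  exists a, x = a *: c.
Proof.
move=> [c0 cc prim] cx.
have [a [e [e0 ee ce xe]]] := exists_spectral_idempotent c0 cc cx.
suff /subr0_eq cE : c - e = 0 by exists a; rewrite -cx cE jmulC.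
apply: contra_notP prim => /eqP ce0; exists e, (c - e).
by split=> //; [exact: idempotentB | rewrite addrC subrK].
Qed.

Definition peirce1_space e : {vspace E} := lker (linfun (jmul e) - \1%VF).

Lemma mem_peirce1_space e x : (x \in peirce1_space e) = (e ** x == x).
Proof. by rewrite memv_ker add_lfunE opp_lfunE id_lfunE lfunE subr_eq0. Qed.

(** Splitting off one spectral idempotent of [x] at a time leaves an element of
    the Peirce space of a smaller idempotent. *)
Lemma peirce1_spectral e x : idempotent_elt e -> e ** x = x ->
  (forall v, 0 <= '<v, (x ** x) ** v>) /\
  ((forall z, e ** z = z -> 0 <= '<x, z ** z>) ->
   exists2 y, e ** y = y & x = y ** y).
Proof.
have [n] := ubnP (\dim (peirce1_space e)).
elim: n e x => // n IHn e x dn ee ex.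
have [e0|e0] := eqVneq e 0.
  move: ex; rewrite e0 jmul0l => <-; split.
    by move=> v; rewrite !jmul0l dot0r.
  by move=> _; exists 0; rewrite !jmul0l.
have [a [f [f0 ff ef xf]]] := exists_spectral_idempotent e0 ee ex.
pose g := e - f; pose y := x - a *: f.
have gg : idempotent_elt g by apply: idempotentB.
have gf : g ** f = 0 by rewrite jmulDl jmulNl ef ff subrr.
have fg : f ** g = 0 by rewrite jmulC.
have fE1 z : g ** z = z -> f ** z = 0.
  by move=> gz; rewrite jmulC (peirce10_orthogonal gg).
have gE1 z : g ** z = z -> e ** z = z.
  by move=> gz; rewrite -(subrK f e) jmulDl gz fE1// addr0.
have fy : f ** y = 0 by rewrite jmulDr jmulNr jmulZr ff jmulC xf subrr.
have gy : g ** y = y.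
  by rewrite jmulDl jmulNl fy subr0 jmulDr jmulNr jmulZr ex ef.
have dg : (\dim (peirce1_space g) < n)%N.
  rewrite -ltnS (leq_trans _ dn)// ltnS ltn_neqAle.
  have sub : (peirce1_space g <= peirce1_space e)%VS.
    by apply/subvP => z; rewrite !mem_peirce1_space => /eqP/gE1 ->.
  rewrite dimvS// andbT; apply: contraNneq f0 => dE.
  have /eqP gE : (peirce1_space g == peirce1_space e) by rewrite eqEdim sub dE
    leqnn.
  have : f \in peirce1_space g by rewrite gE mem_peirce1_space ef.
  by rewrite mem_peirce1_space gf eq_sym.
have [psd sq] := IHn g y dg gg gy.
have xE : x = a *: f + y by rewrite addrC subrK.
have mulE k z : f ** z = 0 ->
    (k *: f + z) ** (k *: f + z) = k ^+ 2 *: f + z ** z.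
  move=> fz; rewrite !jmulE ff (jmulC z f) fz !scaler0 addr0 add0r.
  by rewrite scalerA expr2.
have faE z : g ** z = z -> '<f, z ** z> = 0.
  by move=> gz; rewrite -jdotA fE1// dot0l.
split=> [v|pos].
  rewrite xE mulE// jmulDl jmulZl dotDr dotZr addr_ge0//.
  by rewrite mulr_ge0 ?sqr_ge0 ?idempotent_psd.
have a0 : 0 <= a.
  have := pos f ef.
  by rewrite -jdotA xf dotZl pmulr_lge0// dot_gt0.
have [z gz|z gz zE] := sq.
  by have := pos z (gE1 z gz); rewrite xE dotDl dotZl faE// mulr0 add0r.
exists (Num.sqrt a *: f + z).
  by rewrite jmulDr jmulZr ef gE1.
by rewrite mulE ?fE1// sqr_sqrtr// -zE.
Qed.

(** Self-duality of the cone of squares, whence its convexity. *)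
Lemma square_coneP x :
  square_cone E x <-> forall z, 0 <= '<x, z ** z>.
Proof.
have one : idempotent_elt (jone : E) by apply: jmul1x.
split=> [[y ->] z|pos].
  have [psd _] := peirce1_spectral one (jmul1x y).
  by rewrite dotC jdotA (jmulC z).
have [_ []] := peirce1_spectral one (jmul1x x); first by move=> z _.
by move=> y _ ->; exists y.
Qed.

Lemma square_coneD x y : square_cone E x -> square_cone E y ->
  square_cone E (x + y).
Proof.
move=> /square_coneP Kx /square_coneP Ky; apply/square_coneP => z.
by rewrite dotDl addr_ge0.
Qed.

Lemma square_coneZ k x : 0 <= k -> square_cone E x -> square_cone E (k *: x).
Proof.
move=> k0 /square_coneP Kx; apply/square_coneP => z.
by rewrite dotZl mulr_ge0.
Qed.

Lemma square_cone0 : square_cone E 0.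
Proof. by exists 0; rewrite jmul0l. Qed.
End PrimitiveIdempotent.

(** * A non-exposed face in the connected case *)

Section SymmetricFrame.
Variables (R : realType) (E : ejaType R).

Local Notation "x ** y" := (jmul x y).
Local Notation "''<' x , y >" := (jdot x y).
Local Notation h := (2^-1 : R).

(** The multiplication table of the real symmetric 3 by 3 matrices: [ci] is the
    i-th diagonal unit and [u], [v], [w] are the sums of the two matrix units in
    the positions 12, 23 and 13. *)
Record symmetric_frame (c1 c2 c3 u v w : E) : Prop := SymmetricFrame {
  sf_c11 : c1 ** c1 = c1; sf_c22 : c2 ** c2 = c2; sf_c33 : c3 ** c3 = c3;
  sf_c12 : c1 ** c2 = 0; sf_c13 : c1 ** c3 = 0; sf_c23 : c2 ** c3 = 0;
  sf_c1u : c1 ** u = h *: u; sf_c2u : c2 ** u = h *: u; sf_c3u : c3 ** u = 0;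
  sf_c1v : c1 ** v = 0; sf_c2v : c2 ** v = h *: v; sf_c3v : c3 ** v = h *: v;
  sf_c1w : c1 ** w = h *: w; sf_c2w : c2 ** w = 0; sf_c3w : c3 ** w = h *: w;
  sf_uu : u ** u = c1 + c2; sf_vv : v ** v = c2 + c3; sf_ww : w ** w = c1 + c3;
  sf_uv : u ** v = h *: w; sf_uw : u ** w = h *: v; sf_vw : v ** w = h *: u;
  sf_one : c1 + c2 + c3 = jone }.

Section Connected.
Variables c1 c2 c3 u v : E.
Hypotheses (c11 : c1 ** c1 = c1) (c22 : c2 ** c2 = c2) (c33 : c3 ** c3 = c3).
Hypotheses (c12 : c1 ** c2 = 0) (c13 : c1 ** c3 = 0) (c23 : c2 ** c3 = 0).
Hypothesis sum_c : c1 + c2 + c3 = jone.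
Hypotheses (c1u : c1 ** u = h *: u) (c2u : c2 ** u = h *: u) (c3u : c3 ** u =
  0).
Hypotheses (c1v : c1 ** v = 0) (c2v : c2 ** v = h *: v) (c3v : c3 ** v = h *:
  v).
Hypotheses (uu : u ** u = c1 + c2) (vv : v ** v = c2 + c3).

Let w := 2 *: (u ** v).

Let c1w : c1 ** w = h *: w.
Proof.
by rewrite /w jmulZr (jmulC u) (peirce0_commutes c11 _ c1v) c1u jmulZr !scalerA
  mulrC.
Qed.

Let c3w : c3 ** w = h *: w.
Proof.
by rewrite /w jmulZr (peirce0_commutes c33 _ c3u) c3v jmulZr !scalerA mulrC.
Qed.

Let c2w : c2 ** w = 0.
Proof.
have : jone ** w = w := jmul1x w.
rewrite -sum_c !jmulDl c1w c3w => e; apply: (dot_inj (dot := jdot)) => t.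
by have := congr1 (jdot^~ t) e; rewrite !dotE; lra.
Qed.

Let c2uv : (u ** v) ** c2 = 0.
Proof.
have /eqP := c2w; rewrite /w jmulZr scaler_eq0 pnatr_eq0 /= => /eqP <-.
exact: jmulC.
Qed.

Let uw : u ** w = h *: v.
Proof.
have := jordan_linearized u c2 v.
rewrite uu jmulDl c12 c22 add0r c2uv (jmulC v) c2v (jmulC u c2) c2u.
rewrite !jmulE c1v c2v !(jmulC _ u) /w ?jmulZr.
by move=> e; apply: (dot_inj (dot := jdot)) => t;
  have := congr1 (jdot^~ t) e; rewrite !dotE; lra.
Qed.

Let vw : v ** w = h *: u.
Proof.
have := jordan_linearized v c2 u.
rewrite vv jmulDl c22 (jmulC c3) c23 addr0 (jmulC v u) c2uv (jmulC u) c2u.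
rewrite (jmulC v c2) c2v !jmulE c2u c3u !(jmulC _ v) /w ?jmulZr.
by move=> e; apply: (dot_inj (dot := jdot)) => t;
  have := congr1 (jdot^~ t) e; rewrite !dotE; lra.
Qed.

Let ww : w ** w = c1 + c3.
Proof.
have e1 : (u ** v) ** v = 4^-1 *: u.
  apply: (dot_inj (dot := jdot)) => t; have := congr1 (jdot^~ t) vw.
  by rewrite /w (jmulC v) jmulZl !dotE; lra.
have e2 : u ** u ** (v ** v) = c2.
  by rewrite uu vv jmulDl !jmulDr c12 c13 c22 c23 !(add0r, addr0).
have := jordan_linearized u v v; rewrite e1 e2 {1}uu jmulDl c1v c2v add0r.
rewrite !jmulZr uu vv => e; rewrite /w jmulZl ?jmulZr.
by apply: (dot_inj (dot := jdot)) => t; have := congr1 (jdot^~ t) e;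
  rewrite !dotE; lra.
Qed.

Lemma connected_symmetric_frame : symmetric_frame c1 c2 c3 u v w.
Proof. by split=> //; rewrite /w scalerA mulVf ?scale1r// pnatr_eq0. Qed.
End Connected.

Variables c1 c2 c3 u v w : E.
Hypothesis fr : symmetric_frame c1 c2 c3 u v w.

Let table := (sf_c11 fr, sf_c22 fr, sf_c33 fr, sf_c12 fr, sf_c13 fr, sf_c23 fr,
  sf_c1u fr, sf_c2u fr, sf_c3u fr, sf_c1v fr, sf_c2v fr, sf_c3v fr, sf_c1w fr,
  sf_c2w fr, sf_c3w fr, sf_uu fr, sf_vv fr, sf_ww fr, sf_uv fr, sf_uw fr,
  sf_vw fr).

(** The element that corresponds to the symmetric matrix with diagonal
    [x1 x2 x3] and entries [p], [q], [r] in the positions 12, 23 and 13. *)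
Definition symel x1 x2 x3 p q r : E :=
  x1 *: c1 + x2 *: c2 + x3 *: c3 + p *: u + q *: v + r *: w.

Lemma symel_square x1 x2 x3 p q r :
  symel x1 x2 x3 p q r ** symel x1 x2 x3 p q r =
  symel (x1 ^+ 2 + p ^+ 2 + r ^+ 2) (x2 ^+ 2 + p ^+ 2 + q ^+ 2)
        (x3 ^+ 2 + q ^+ 2 + r ^+ 2)
        (p * (x1 + x2) + q * r) (q * (x2 + x3) + p * r) (r * (x1 + x3) + p * q).
Proof.
rewrite /symel !jmulDl !jmulDr !jmulZl !jmulZr.
rewrite (jmulC c2 c1) (jmulC c3 c1) (jmulC c3 c2) (jmulC u c1) (jmulC u c2).
rewrite (jmulC u c3) (jmulC v c1) (jmulC v c2) (jmulC v c3) (jmulC v u).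
rewrite (jmulC w c1) (jmulC w c2) (jmulC w c3) (jmulC w u) (jmulC w v).
rewrite !table.
by apply: (dot_inj (dot := jdot)) => t; rewrite !dotE; field.
Qed.

End SymmetricFrame.

Section SymmetricElements.
Variables (R : realType) (E : ejaType R).

Local Notation "x ** y" := (jmul x y).
Local Notation "''<' x , y >" := (jdot x y).
Local Notation h := (2^-1 : R).

Variables c1 c2 c3 u v w : E.
Hypothesis fr : symmetric_frame c1 c2 c3 u v w.
Local Notation sym := (symel c1 c2 c3 u v w).

(** The matrix [n n^T] of the column [n] with entries [a], [b], [c]. *)
Definition rank1 a b c : E :=
  sym (a ^+ 2) (b ^+ 2) (c ^+ 2) (a * b) (b * c) (a * c).

Lemma rank1_square_cone a b c : square_cone E (rank1 a b c).
Proof.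
set N := a ^+ 2 + b ^+ 2 + c ^+ 2.
have N0 : 0 <= N by rewrite !addr_ge0 ?sqr_ge0.
have sq : rank1 a b c ** rank1 a b c = N *: rank1 a b c.
  rewrite /rank1 (symel_square fr) /symel; apply: (dot_inj (dot := jdot)) => t.
  by rewrite !dotE /N; ring.
have [Nz|Nn0] := eqVneq N 0.
  have [-> -> ->] : [/\ a = 0, b = 0 & c = 0] by split; rewrite /N in Nz; nra.
  rewrite /rank1 /symel expr0n mul0r !scale0r !addr0; exact: square_cone0.
exists ((Num.sqrt N)^-1 *: rank1 a b c).
by rewrite jmulZl jmulZr sq !scalerA -invfM -expr2 sqr_sqrtr// mulVf// scale1r.
Qed.

Let dot_eigen (c x y : E) (k l : R) :
  c ** x = k *: x -> c ** y = l *: y -> k != l -> '<x, y> = 0.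
Proof.
move=> cx cy kl; have : k * '<x, y> = l * '<x, y>.
  by rewrite -dotZl -cx jmulC jdotA cy dotZr.
by move/eqP; rewrite -subr_eq0 -mulrBl mulf_eq0 subr_eq0 (negPf kl) => /eqP.
Qed.

Let dot_peirce1_half (c x y : E) : c ** x = x -> c ** y = h *: y -> '<x, y> = 0.
Proof.
move=> cx cy; apply: (@dot_eigen c _ _ 1 h); rewrite ?scale1r//.
by apply/eqP; lra.
Qed.

Let dot_peirce10 (c x y : E) : c ** x = x -> c ** y = 0 -> '<x, y> = 0.
Proof.
by move=> cx cy; apply: (@dot_eigen c _ _ 1 0); rewrite ?scale1r ?scale0r.
Qed.

Let dot_peirce_half0 (c x y : E) : c ** x = h *: x -> c ** y = 0 -> '<x, y> = 0.
Proof.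
by move=> cx cy; apply: (@dot_eigen c _ _ h 0); rewrite ?scale0r ?invr_eq0.
Qed.

Let dot_half_square (c x : E) : c ** x = h *: x -> '<c, x ** x> = h * '<x, x>.
Proof. by move=> cx; rewrite -jdotA cx dotZl. Qed.

Local Notation kappa := '<c1, c1>.

Lemma dot_symel x1 x2 x3 p q r y1 y2 y3 p' q' r' :
  '<sym x1 x2 x3 p q r, sym y1 y2 y3 p' q' r'> =
  kappa * (x1 * y1 + x2 * y2 + x3 * y3 + 2 * (p * p' + q * q' + r * r')).
Proof.
have [c11 c22 c33 c12 c13 c23 c1u c2u c3u] := fr.
move=> c1v c2v c3v c1w c2w c3w uu vv ww _ _ _ _.
have d12 := dot_peirce10 c11 c12.
have d13 := dot_peirce10 c11 c13.
have d23 := dot_peirce10 c22 c23.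
have d1u := dot_peirce1_half c11 c1u.
have d1v := dot_peirce10 c11 c1v.
have d1w := dot_peirce1_half c11 c1w.
have d2u := dot_peirce1_half c22 c2u.
have d2v := dot_peirce1_half c22 c2v.
have d2w := dot_peirce10 c22 c2w.
have d3u := dot_peirce10 c33 c3u.
have d3v := dot_peirce1_half c33 c3v.
have d3w := dot_peirce1_half c33 c3w.
have duv := dot_peirce_half0 c1u c1v.
have duw := dot_peirce_half0 c2u c2w.
have dwv := dot_peirce_half0 c1w c1v.
have := dot_half_square c1u; have := dot_half_square c2u.
have := dot_half_square c2v; have := dot_half_square c3v.
have := dot_half_square c1w.
rewrite uu vv ww !dotDr (dotC _ c2 c1) (dotC _ c3 c2) d12 d13 d23 !add0r !addr0.
move=> nw n33 n2v n22 nu.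
have {}nu : '<u, u> = 2 * kappa by rewrite nu mulVKf ?pnatr_eq0.
have {}nw : '<w, w> = 2 * kappa by rewrite nw mulVKf ?pnatr_eq0.
rewrite nu mulKf ?pnatr_eq0// in n22; rewrite -n2v n22 in n33.
have nv : '<v, v> = 2 * kappa by rewrite -n22 n2v mulVKf ?pnatr_eq0.
rewrite /symel !(dotDl, dotDr) !(dotZl, dotZr) (dotC _ c2 c1) (dotC _ c3 c1)
  (dotC _ c3 c2).
rewrite (dotC _ u c1) (dotC _ u c2) (dotC _ u c3) (dotC _ v c1) (dotC _ v c2).
rewrite (dotC _ v c3) (dotC _ w c1) (dotC _ w c2) (dotC _ w c3) (dotC _ v u).
rewrite (dotC _ w u) (dotC _ v w) d12 d13 d23 d1u d1v d1w d2u d2v d2w d3u d3v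
  d3w.
rewrite duv duw dwv nu nv nw n22 n33; ring.
Qed.


Hypothesis c10 : c1 != 0.

Let s : R := Num.sqrt 2^-1.

Let s2 : s ^+ 2 = 2^-1.
Proof. by rewrite sqr_sqrtr. Qed.

Let kappa_gt0 : 0 < kappa.
Proof. exact: dot_gt0. Qed.

(** A matrix with these entries is [x + y S_z + z S_x] for the spin-one
    matrices [S_z] and [S_x]. It has the eigenvalues [x] and [x +- sqrt (y^2
    + z^2)], so the elements of this form meet the cone of squares in a
    Lorentz cone; the kernels of its extreme rays lie in no common plane. *)
Definition lor_element x y z : E := sym (x + y) x (x - y) (z * s) (z * s) 0.

Lemma psd_form2 (a b c : R) :
  (forall x y, 0 <= a * x ^+ 2 + 2 * b * x * y + c * y ^+ 2) -> b ^+ 2 <= a * c.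
Proof.
move=> pos; have a0 : 0 <= a by have := pos 1 0; lra.
have [a0'|a_gt0] := leP a 0.
  have aE : a = 0 by lra.
  by have := pos (- (c + 1)) (2 * b); rewrite aE; lra.
rewrite -(ler_pM2l a_gt0); have := pos (- b) a; lra.
Qed.

(** Pairing with the rank-one matrices of the kernels of the extreme rays
    gives a nonnegative binary quadratic form, whose discriminant is the
    claim. *)
Lemma lor_square_cone x y z : square_cone E (lor_element x y z) ->
  y ^+ 2 + z ^+ 2 <= x ^+ 2.
Proof.
move=> /square_coneP K.
suff : z ^+ 2 <= (x + y) * (x - y) by lra.
apply: psd_form2 => a b.
have [r rE] := rank1_square_cone (a ^+ 2) (2 * s * a * b) (b ^+ 2).
have := K r; rewrite -rE /rank1 /lor_element dot_symel (pmulr_rge0 _ kappa_gt0).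
set t := (X in 0 <= X) => t0.
have tE : t = (a ^+ 2 + b ^+ 2) *
    ((x + y) * a ^+ 2 + 2 * z * a * b + (x - y) * b ^+ 2).
  have -> : t = (x + y) * a ^+ 4 + 4 * s ^+ 2 * x * (a * b) ^+ 2
    + (x - y) * b ^+ 4 + 4 * s ^+ 2 * z * a * b * (a ^+ 2 + b ^+ 2).
    by rewrite /t; ring.
  by rewrite s2; field.
have [ab|ab] := leP (a ^+ 2 + b ^+ 2) 0.
  have [-> ->] : a = 0 /\ b = 0 by split; nra.
  by rewrite !expr0n !mulr0 !addr0.
by rewrite -(pmulr_rge0 _ ab) -tE.
Qed.
End SymmetricElements.

Section LorentzFace.
Variables (R : realType) (E : ejaType R).

Local Notation "x ** y" := (jmul x y).
Local Notation "''<' x , y >" := (jdot x y).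

Variables c1 c2 c3 u v w : E.
Hypothesis fr : symmetric_frame c1 c2 c3 u v w.
Hypothesis c10 : c1 != 0.

Local Notation sym := (symel c1 c2 c3 u v w).
Local Notation lor := (lor_element c1 c2 c3 u v w).
Local Notation kappa := '<c1, c1>.
Local Notation ts := (tensor_square (@jdot R E)).
Local Notation K := (square_cone E).
Local Notation CP := (completely_positive (@jdot R E) K).

Let s : R := Num.sqrt 2^-1.

Let s2 : s ^+ 2 = 2^-1.
Proof. by rewrite sqr_sqrtr. Qed.

Let kappa_gt0 : 0 < kappa.
Proof. exact: dot_gt0. Qed.

Lemma lorE x y z : lor x y z = x *: lor 1 0 0 + y *: lor 0 1 0 + z *: lor 0 0 1.
Proof.
by apply: (dot_inj (dot := jdot)) => t; rewrite /lor_element /symel !dotE; ring.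
Qed.

Lemma dot_lor x y z x' y' z' :
  '<lor x y z, lor x' y' z'> = kappa * (3 * x * x' + 2 * y * y' + 2 * z * z').
Proof.
rewrite /lor_element (dot_symel fr) -/s; congr (_ * _).
transitivity (3 * x * x' + 2 * y * y' + 4 * s ^+ 2 * z * z'); first by ring.
by rewrite s2; field.
Qed.

Definition lor_orthogonal y : Prop :=
  [/\ '<lor 1 0 0, y> = 0, '<lor 0 1 0, y> = 0 & '<lor 0 0 1, y> = 0].

Lemma lor_projection a : exists x y z r, lor_orthogonal r /\ a = lor x y z + r.
Proof.
have k0 := lt0r_neq0 kappa_gt0.
exists ('<lor 1 0 0, a> / (3 * kappa)), ('<lor 0 1 0, a> / (2 * kappa)),
  ('<lor 0 0 1, a> / (2 * kappa)); set b := lor _ _ _.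
exists (a - b); split; last by rewrite addrC subrK.
by split; rewrite dotDr dotNr dot_lor; field; rewrite k0.
Qed.

Lemma lor_orthogonalP x y z r : lor_orthogonal r -> '<r, lor x y z> = 0.
Proof.
move=> [r1 r2 r3]; rewrite dotC lorE.
move: (lor 1 0 0) (lor 0 1 0) (lor 0 0 1) r1 r2 r3 => e1 e2 e3 r1 r2 r3.
by rewrite !dotE r1 r2 r3; ring.
Qed.

(** Up to a positive factor, the linear extension to operators of the Lorentz
    form [x^2 - y^2 - z^2], defined on the squares of the [lor x y z]; the
    denominators come from the norms of the three basis vectors. *)
Definition lor_value (f : 'End(E)) : R :=
  '<lor 1 0 0, f (lor 1 0 0)> / 9 - '<lor 0 1 0, f (lor 0 1 0)> / 4
  - '<lor 0 0 1, f (lor 0 0 1)> / 4.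

Lemma lor_valueD f g : lor_value (f + g) = lor_value f + lor_value g.
Proof.
rewrite /lor_value; move: (lor 1 0 0) (lor 0 1 0) (lor 0 0 1) => e1 e2 e3.
by rewrite !add_lfunE !dotE; ring.
Qed.

Lemma lor_valueZ k f : lor_value (k *: f) = k * lor_value f.
Proof.
rewrite /lor_value; move: (lor 1 0 0) (lor 0 1 0) (lor 0 0 1) => e1 e2 e3.
by rewrite !scale_lfunE !dotE; ring.
Qed.

Lemma lor_value_tensor x y z :
  lor_value (ts (lor x y z)) = kappa ^+ 2 * (x ^+ 2 - y ^+ 2 - z ^+ 2).
Proof.
by rewrite /lor_value !tensor_squareE !dotZr !dot_lor; field.
Qed.

Definition lor_supported (f : 'End(E)) : Prop :=
  forall r, lor_orthogonal r -> '<r, f r> = 0.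

Lemma lor_supported_tensor a : lor_supported (ts a) ->
  exists x y z, a = lor x y z.
Proof.
move=> sa; have [x [y [z [r [ro aE]]]]] := lor_projection a.
exists x, y, z; suff r0 : r = 0 by rewrite aE r0 addr0.
apply: (dot_eq0 (dot := jdot)); have := sa r ro.
have <- : '<a, r> = '<r, r>.
  by rewrite aE dotDl (dotC _ _ r) lor_orthogonalP// add0r.
by rewrite tensor_squareE dotZr (dotC _ r a) => /eqP;
  rewrite mulf_eq0 orbb => /eqP ->.
Qed.

Let tensor_ge0 a r : 0 <= '<r, ts a r>.
Proof. by rewrite tensor_squareE dotZr (dotC _ r a) -expr2 sqr_ge0. Qed.

Lemma completely_positive_psd f r : CP f -> 0 <= '<r, f r>.
Proof.
move=> /(completely_positiveP _ (square_cone0 E))[t _ ->].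
by rewrite sum_lfunE dot_sumr sumr_ge0// => a _.
Qed.

Lemma lor_value_ge0 f : CP f -> lor_supported f -> 0 <= lor_value f.
Proof.
move=> /(completely_positiveP _ (square_cone0 E))[t Kt ->].
elim: t Kt => [|a t IHt] Kt sf.
  by rewrite big_nil /lor_value !zero_lfunE !dot0r; lra.
have Kt' b : b \in t -> K b by move=> bt; apply: Kt; rewrite inE bt orbT.
rewrite big_cons lor_valueD.
have CPt : CP (\sum_(b <- t) ts b).
  by apply: completely_positive_sum => //; exact: square_cone0.
have [sa st] : lor_supported (ts a) /\ lor_supported (\sum_(b <- t) ts b).
  split=> r ro; have := sf r ro; rewrite big_cons add_lfunE dotDr;
  have := tensor_ge0 a r; have := completely_positive_psd r CPt; lra.
apply: addr_ge0; last exact: IHt.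
have [x [y [z aE]]] := lor_supported_tensor sa.
have Ka : K (lor x y z) by rewrite -aE; apply: Kt; rewrite mem_head.
rewrite aE lor_value_tensor mulr_ge0 ?sqr_ge0//.
by have := lor_square_cone fr c10 Ka; lra.
Qed.

Definition lor_face : set 'End(E) :=
  [set f | [/\ CP f, lor_supported f & lor_value f = 0]].

Lemma lor_face_is_face : is_face CP lor_face.
Proof.
have CPD f g : CP f -> CP g -> CP (f + g).
  by apply: completely_positiveD; exact: square_cone0.
have CPZ k f : 0 <= k -> CP f -> CP (k *: f).
  by apply: completely_positiveZ => //; [exact: square_cone0|move=> *;
    exact: square_coneZ].
have FZ : is_cone lor_face.
  move=> k f k0 [Cf sf vf]; split; first exact: CPZ.
    by move=> r ro; rewrite scale_lfunE dotZr sf// mulr0.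
  by rewrite lor_valueZ vf mulr0.
split=> //.
- exists 0; split; first exact/completely_positive0/square_cone0.
    by move=> r _; rewrite zero_lfunE dot0r.
  by rewrite /lor_value !zero_lfunE !dot0r; lra.
- apply: cone_convex => // f g [Cf sf vf] [Cg sg vg]; split; first exact: CPD.
    by move=> r ro; rewrite add_lfunE dotDr sf// sg// addr0.
  by rewrite lor_valueD vf vg addr0.
- by move=> f [].
move=> f g Cf Cg [_ sfg vfg].
have [sf sg] : lor_supported f /\ lor_supported g.
  by split=> r ro; have := sfg r ro; rewrite add_lfunE dotDr;
    have := completely_positive_psd r Cf; have := completely_positive_psd r Cg;
    lra.
have := lor_value_ge0 Cf sf; have := lor_value_ge0 Cg sg.
by move: vfg; rewrite lor_valueD => vfg g0 f0; split; split=> //; lra.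
Qed.

Lemma lor_face_not_exposed :
  ~ is_exposed_face (self_adjoint (@jdot R E)) trace_form CP lor_face.
Proof.
move=> [d dd FE]; pose g x y := '<x, d y>.
have K0 := square_cone0 E.
have KD := @square_coneD R E.
have KZ : is_cone K by move=> *; apply: square_coneZ.
have [sd pd] := (dual_completely_positiveP _ K0 d).1 dd.
have gC x y : g x y = g y x by rewrite /g -sd dotC.
have gDl x y z : g (x + y) z = g x z + g y z by apply: dotDl.
have gZl k x y : g (k *: x) y = k * g x y by apply: dotZl.
have zero x y z : K (lor x y z) -> x ^+ 2 - y ^+ 2 - z ^+ 2 = 0 ->
    g (lor x y z) (lor x y z) = 0.
  move=> Ka q0; have : lor_face (ts (lor x y z)).
    split; first exact: completely_positive_tensor.
      move=> r ro; rewrite tensor_squareE dotZr lor_orthogonalP// mulr0//.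
    by rewrite lor_value_tensor q0 mulr0.
  by rewrite FE => -[_]; rewrite /= trace_form_tensor_square.
have pos x y : K x -> K y -> g y y = 0 -> 0 <= g x y.
  by move=> Kx Ky; apply: (copositive_zero_ge0 K0 KZ).
have [Kc1 Kc2 Kc3] : [/\ K c1, K c2 & K c3].
  by split; [exists c1|exists c2|exists c3];
    rewrite ?(sf_c11 fr, sf_c22 fr, sf_c33 fr).
have sumA : lor 1 1 0 + lor 1 (-1) 0 = 2 *: lor 1 0 0.
  by apply: (dot_inj (dot := jdot)) => t; rewrite /lor_element /symel !dotE;
    ring.
have sumB : lor 1 0 1 + lor 1 0 (-1) = 2 *: lor 1 0 0.
  by apply: (dot_inj (dot := jdot)) => t; rewrite /lor_element /symel !dotE;
    ring.
have Ap : lor 1 1 0 = 2 *: c1 + c2.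
  by apply: (dot_inj (dot := jdot)) => t; rewrite /lor_element /symel !dotE;
    ring.
have Am : lor 1 (-1) 0 = 2 *: c3 + c2.
  by apply: (dot_inj (dot := jdot)) => t; rewrite /lor_element /symel !dotE;
    ring.
have oneE : lor 1 0 0 = c1 + c2 + c3.
  by apply: (dot_inj (dot := jdot)) => t; rewrite /lor_element /symel !dotE;
    ring.
have KAp : K (lor 1 1 0) by rewrite Ap; apply: (KD) => //; apply: KZ.
have KAm : K (lor 1 (-1) 0) by rewrite Am; apply: (KD) => //; apply: KZ.
have Kone : K (lor 1 0 0) by rewrite oneE; do 2!apply: (KD) => //.
have Krank1 a b c : K (rank1 c1 c2 c3 u v w a b c) by apply: rank1_square_cone.
have KB e : e ^+ 2 = 1 -> K (lor 1 0 e).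
  move=> e2; have -> : lor 1 0 e = 2^-1 *: rank1 c1 c2 c3 u v w 1 0 (-1)
      + 2 *: rank1 c1 c2 c3 u v w 2^-1 (e * s) 2^-1.
    apply: (dot_inj (dot := jdot)) => t.
    by rewrite /rank1 /lor_element /symel !dotE !exprMn -/s s2 e2; field.
  by apply: KD; apply: KZ.
have [KBp KBm] : K (lor 1 0 1) /\ K (lor 1 0 (-1)) by split; apply: KB; ring.
have zAp : g (lor 1 1 0) (lor 1 1 0) = 0 by apply: zero => //; ring.
have zAm : g (lor 1 (-1) 0) (lor 1 (-1) 0) = 0 by apply: zero => //; ring.
have zBp : g (lor 1 0 1) (lor 1 0 1) = 0 by apply: zero => //; ring.
have zBm : g (lor 1 0 (-1)) (lor 1 0 (-1)) = 0 by apply: zero => //; ring.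
have c2Ap : g c2 (lor 1 1 0) = 0.
  have := pos c1 _ Kc1 KAp zAp; have := pos c2 _ Kc2 KAp zAp.
  by move: zAp; rewrite {1}Ap gDl gZl; lra.
have c2Am : g c2 (lor 1 (-1) 0) = 0.
  have := pos c3 _ Kc3 KAm zAm; have := pos c2 _ Kc2 KAm zAm.
  by move: zAm; rewrite {1}Am gDl gZl; lra.
have c2one : g (lor 1 0 0) c2 = 0.
  have := congr1 (g^~ c2) sumA.
  by rewrite gDl gZl gC c2Ap gC c2Am; lra.
have [c2Bp c2Bm] : g c2 (lor 1 0 1) = 0 /\ g c2 (lor 1 0 (-1)) = 0.
  have := congr1 (g^~ c2) sumB; rewrite gDl gZl c2one !(gC _ c2).
  by have := pos c2 _ Kc2 KBp zBp; have := pos c2 _ Kc2 KBm zBm; split; lra.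
(* [lor 1 0 e] and [c2] have no common kernel vector, so some combination of
   them exceeds the unit [lor 1 0 0]; the matrix of the difference is a sum of
   two rank-one matrices. *)
have oneB e : e ^+ 2 = 1 -> g (lor 1 0 e) (lor 1 0 e) = 0 ->
    g c2 (lor 1 0 e) = 0 -> g (lor 1 0 0) (lor 1 0 e) <= 0.
  move=> e2 zB c2B; have Kr := fun a b c => pos _ _ (Krank1 a b c) (KB e e2) zB.
  have : 4 *: lor 1 0 e + (7 / 3) *: c2 =
      lor 1 0 0 + 3^-1 *: rank1 c1 c2 c3 u v w 3 (4 * e * s) 0
      + 3^-1 *: rank1 c1 c2 c3 u v w 0 (4 * e * s) 3.
    apply: (dot_inj (dot := jdot)) => t.
    by rewrite /rank1 /lor_element /symel !dotE !exprMn -/s s2 e2; field.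
  move/(congr1 (g^~ (lor 1 0 e))); rewrite !gDl !gZl zB c2B.
  by have := Kr 3 (4 * e * s) 0; have := Kr 0 (4 * e * s) 3; lra.
have one0 : g (lor 1 0 0) (lor 1 0 0) = 0.
  have em : (-1) ^+ 2 = 1 :> R by ring.
  have gm := oneB (-1) em zBm c2Bm.
  have gp := oneB 1 (expr1n _ 2) zBp c2Bp.
  have g0 : 0 <= g (lor 1 0 0) (lor 1 0 0) by apply: pd.
  have := congr1 (g^~ (lor 1 0 0)) sumB.
  by rewrite gDl gZl (gC (lor 1 0 1)) (gC (lor 1 0 (-1))); lra.
have : lor_face (ts (lor 1 0 0)).
  rewrite FE; split; first exact: completely_positive_tensor.
  by rewrite /= trace_form_tensor_square.
case=> _ _; rewrite lor_value_tensor => /eqP.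
by rewrite mulf_eq0 expf_eq0 /= gt_eqF//= => /eqP; lra.
Qed.
End LorentzFace.

(** * Frames of simple algebras are connected *)

Section Frames.
Variables (R : realType) (E : ejaType R).
Implicit Types (c d e u v x y z : E).

Local Notation "x ** y" := (jmul x y).
Local Notation "''<' x , y >" := (jdot x y).
Local Notation h := (2^-1 : R).

Lemma orthogonal_idempotents_dot c d : idempotent_elt c -> c ** d = 0 ->
  '<c, d> = 0.
Proof. by move=> cc cd; rewrite -{1}cc jdotA cd dot0r. Qed.

(** A priori [u ** u = a c + b d]. Then [(u ** u) ** u] is [(a + b) / 2 u], and
    the Jordan identity [u ** ((u ** u) ** u) = (u ** u) ** (u ** u)] forces
    [a = b]. *)
Lemma peirce12_square c d u :
  primitive_idempotent c -> primitive_idempotent d -> c ** d = 0 ->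
  c ** u = h *: u -> d ** u = h *: u ->
  exists a, [/\ u ** u = a *: (c + d), h * '<u, u> = a * '<c, c> &
               h * '<u, u> = a * '<d, d> ].
Proof.
move=> pc pd cd cu du; have [[c0 cc _] [d0 dd _]] := (pc, pd).
have dc : d ** c = 0 by rewrite jmulC.
have ee : idempotent_elt (c + d).
  by rewrite /idempotent_elt jmulDl !jmulDr cc dd cd dc addr0 add0r.
have eu : (c + d) ** u = u.
  by rewrite jmulDl cu du -scalerDl (_ : h + h = 1) ?scale1r//; field.
have [a ca] := primitive_peirce1 pc (peirce_half_square cc cu).
have [b db] := primitive_peirce1 pd (peirce_half_square dd du).
have uuE : u ** u = a *: c + b *: d.
  by rewrite -ca -db -jmulDl (peirce1_commutes ee _ eu) eu.
have cdot := orthogonal_idempotents_dot cc cd.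
have c_gt0 := dot_gt0 jdot c0; have d_gt0 := dot_gt0 jdot d0.
have ab : a = b.
  have uc : u ** c = h *: u by rewrite jmulC.
  have ud : u ** d = h *: u by rewrite jmulC.
  have cube : (u ** u) ** u = (h * (a + b)) *: u.
    rewrite uuE jmulDl !jmulZl cu du !scalerA -scalerDl; congr (_ *: _); ring.
  have := jmul_jordan u u; rewrite cube jmulZr uuE.
  rewrite !jmulDl !jmulDr !jmulZl !jmulZr cc dd cd dc !scaler0 addr0 add0r => e.
  have ea : h * (a + b) * a = a * a.
    apply: (mulIf (lt0r_neq0 c_gt0)); have := congr1 (jdot c) e.
    by rewrite !dotE cdot !mulr0 !addr0 -!mulrA.
  have eb : h * (a + b) * b = b * b.
    apply: (mulIf (lt0r_neq0 d_gt0)); have := congr1 (jdot d) e.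
    by rewrite !dotE (dotC _ d c) cdot !mulr0 !add0r -!mulrA.
  by apply/eqP; rewrite -subr_eq0 -sqrf_eq0; apply/eqP; lra.
exists a; split.
- by rewrite uuE -ab scalerDr.
- by rewrite -dotZl -cu jdotA uuE dotDr !dotZr cdot mulr0 addr0.
- by rewrite -dotZl -du jdotA uuE dotDr !dotZr (dotC _ d c) cdot mulr0 add0r ab.
Qed.

(** The graph on a frame formed by the nonzero off-diagonal Peirce spaces. *)
Definition edge c d :=
  exists u, [/\ u != 0, c ** u = h *: u & d ** u = h *: u].

Lemma edgeC c d : edge c d -> edge d c.
Proof. by move=> [u [u0 cu du]]; exists u. Qed.

Lemma edge_normalized c d : primitive_idempotent c -> primitive_idempotent d ->
  c ** d = 0 -> edge c d ->
  exists u, [/\ c ** u = h *: u, d ** u = h *: u & u ** u = c + d].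
Proof.
move=> pc pd cd [u [u0 cu du]]; have [c0 cc _] := pc.
have [a [uu ac _]] := peirce12_square pc pd cd cu du.
have a_gt0 : 0 < a.
  have := dot_gt0 jdot u0; have := dot_gt0 jdot c0; nra.
exists ((Num.sqrt a)^-1 *: u); rewrite !jmulZr !jmulZl cu du uu.
split; try by rewrite !scalerA mulrC.
by rewrite !scalerA -invfM -expr2 sqr_sqrtr ?ltW// mulVf ?gt_eqF// scale1r.
Qed.

(** Two edges of the frame generate a copy of the symmetric 3 by 3 matrices,
    inside which the non-exposed face lives. *)
Lemma path_not_facially_exposed c1 c2 c3 :
  primitive_idempotent c1 -> primitive_idempotent c2 ->
  primitive_idempotent c3 ->
  c1 ** c2 = 0 -> c1 ** c3 = 0 -> c2 ** c3 = 0 -> c1 + c2 + c3 = jone ->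
  edge c1 c2 -> edge c2 c3 ->
  ~ facially_exposed (self_adjoint (@jdot R E)) trace_form
      (completely_positive (@jdot R E) (square_cone E)).
Proof.
move=> p1 p2 p3 c12 c13 c23 sum_c e12 e23.
have [[c10 c11 _] [_ c22 _] [_ c33 _]] := And3 p1 p2 p3.
have [u [c1u c2u uu]] := edge_normalized p1 p2 c12 e12.
have [v [c2v c3v vv]] := edge_normalized p2 p3 c23 e23.
have c3u : c3 ** u = 0.
  have := jmul1x u; rewrite -sum_c !jmulDl c1u c2u => e.
  by apply: (dot_inj (dot := jdot)) => t; have := congr1 (jdot^~ t) e;
    rewrite !dotE; lra.
have c1v : c1 ** v = 0.
  have := jmul1x v; rewrite -sum_c !jmulDl c2v c3v => e.
  by apply: (dot_inj (dot := jdot)) => t; have := congr1 (jdot^~ t) e;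
    rewrite !dotE; lra.
have fr := connected_symmetric_frame c11 c22 c33 c12 c13 c23 sum_c c1u c2u c3u
  c1v c2v c3v uu vv.
move=> /(_ _ (lor_face_is_face fr c10)); exact: lor_face_not_exposed.
Qed.

Definition peirce0_space e : {vspace E} := lker (linfun (jmul e)).

Lemma mem_peirce0_space e x : (x \in peirce0_space e) = (e ** x == 0).
Proof. by rewrite memv_ker lfunE. Qed.

(** Otherwise the Peirce decomposition of [c] splits the algebra. *)
Lemma simple_peirce_half c : simple_eja E -> c != 0 -> c != jone ->
  idempotent_elt c -> exists2 v, v != 0 & c ** v = h *: v.
Proof.
move=> [_ simple] c0 c1 cc; apply: contra_notP simple => no.
exists (peirce1_space c), (peirce0_space c).
have in1 x : x \in peirce1_space c -> c ** x = x.
  by rewrite mem_peirce1_space => /eqP.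
have in0 x : x \in peirce0_space c -> c ** x = 0.
  by rewrite mem_peirce0_space => /eqP.
split.
- split=> x y.
    move=> /in1 cx /in1 cy.
    by rewrite mem_peirce1_space (peirce1_commutes cc _ cx) cy.
  move=> /in0 cx /in0 cy.
  by rewrite mem_peirce0_space (peirce0_commutes cc _ cx) cy jmul0r.
- split=> V0.
    have : c \in peirce1_space c by rewrite mem_peirce1_space cc.
    by rewrite V0 memv0 (negPf c0).
  have : jone - c \in peirce0_space c.
    by rewrite mem_peirce0_space jmulDr jmulNr cc jmulC jmul1x subrr.
  by rewrite V0 memv0 subr_eq0 eq_sym (negPf c1).
- by move=> x y /in1 cx /in0 cy; apply: peirce10_orthogonal cy.
- apply/eqP; rewrite eqEsubv subvf; apply/subvP => v _.
  have half0 : peirce_half c v = 0.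
    have [//|hv] := eqVneq (peirce_half c v) 0.
    by case: no; exists (peirce_half c v) => //; apply: peirce_halfP.
  rewrite (peirce_decomposition c v) half0 addr0 memv_add//.
    by rewrite mem_peirce1_space peirce1P.
  by rewrite mem_peirce0_space peirce0P.
- apply/directv_addP/eqP; rewrite -subv0; apply/subvP => v.
  by rewrite memv_cap => /andP[/in1 cv1 /in0]; rewrite cv1 => ->; rewrite mem0v.
Qed.

Lemma peirce_half_edge c1 c2 c3 v :
  idempotent_elt c1 -> idempotent_elt c2 ->
  c1 ** c2 = 0 -> c1 + c2 + c3 = jone -> v != 0 -> c1 ** v = h *: v ->
  edge c1 c2 \/ edge c1 c3.
Proof.
move=> c11 c22 c12 sum_c v0 c1v.
have c21 : c2 ** c1 = 0 by rewrite jmulC.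
have c1c2 x : c1 ** (c2 ** x) = c2 ** (c1 ** x).
  by rewrite (peirce0_commutes c22).
have half k x : c1 ** (k *: x) = k *: (c1 ** x) by rewrite jmulZr.
have [b0|b0] := eqVneq (peirce_half c2 v) 0; last first.
  left; exists (peirce_half c2 v); split=> //; last exact: peirce_halfP.
  rewrite /peirce_half !jmulE !c1c2 c1v !jmulE.
  by apply: (dot_inj (dot := jdot)) => t; rewrite !dotE; ring.
have a0 : peirce1 c2 v = 0.
  have := peirce10_orthogonal c22 (peirce1P c22 v) c21.
  have -> : peirce1 c2 v ** c1 = h *: peirce1 c2 v.
    rewrite jmulC /peirce1 !jmulE !c1c2 c1v !jmulE.
    by apply: (dot_inj (dot := jdot)) => t; rewrite !dotE; ring.
  by move/eqP; rewrite scaler_eq0 invr_eq0 pnatr_eq0 /= => /eqP.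
have c2v : c2 ** v = 0.
  by rewrite (peirce_decomposition c2 v) a0 b0 !add0r peirce0P.
right; exists v; split=> //; have := jmul1x v.
rewrite -sum_c !jmulDl c1v c2v addr0 => e.
by apply: (dot_inj (dot := jdot)) => t; have := congr1 (jdot^~ t) e;
  rewrite !dotE; lra.
Qed.

(** Every element of a frame of a simple algebra lies on an edge, so the three
    of them form a path. *)
Lemma simple_not_facially_exposed : has_rank E 3 -> simple_eja E ->
  ~ facially_exposed (self_adjoint (@jdot R E)) trace_form
      (completely_positive (@jdot R E) (square_cone E)).
Proof.
move=> [c [pc oc sc]] simple.
pose c1 := c ord0; pose c2 := c (lift ord0 ord0); pose c3 := c ord_max.
have o3 : lift ord0 (lift ord0 ord0) = ord_max :> 'I_3 by apply: val_inj.
have sum_c : c1 + c2 + c3 = jone.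
  by rewrite -sc !big_ord_recl big_ord0 addr0 addrA o3.
have [p1 p2 p3] : [/\ primitive_idempotent c1, primitive_idempotent c2 &
                      primitive_idempotent c3].
  by split; apply: pc.
have [c12 c13 c23] : [/\ c1 ** c2 = 0, c1 ** c3 = 0 & c2 ** c3 = 0].
  by split; apply: oc.
have [[c10 c11 _] [c20 c22 _] [c30 c33 _]] := And3 p1 p2 p3.
have not1 d e : d != 0 -> e ** d = 0 -> e != jone.
  by move=> d0 ed; apply: contraNneq d0 => e1; rewrite -ed e1 jmul1x.
have [v1 v10 cv1] := simple_peirce_half simple c10 (not1 _ _ c20 c12) c11.
have c21 : c2 ** c1 = 0 by rewrite jmulC.
have c31 : c3 ** c1 = 0 by rewrite jmulC.
have c32 : c3 ** c2 = 0 by rewrite jmulC.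
have [v2 v20 cv2] := simple_peirce_half simple c20 (not1 _ _ c10 c21) c22.
have [v3 v30 cv3] := simple_peirce_half simple c30 (not1 _ _ c10 c31) c33.
have s213 : c2 + c1 + c3 = jone by rewrite (addrC c2).
have s312 : c3 + c1 + c2 = jone by rewrite -addrA addrC.
have s132 : c1 + c3 + c2 = jone by rewrite addrAC.
have := peirce_half_edge c11 c22 c12 sum_c v10 cv1.
have := peirce_half_edge c22 c11 c21 s213 v20 cv2.
have := peirce_half_edge c33 c11 c31 s312 v30 cv3.
have path123 := path_not_facially_exposed p1 p2 p3 c12 c13 c23 sum_c.
have path213 := path_not_facially_exposed p2 p1 p3 c21 c23 c13 s213.
have path132 := path_not_facially_exposed p1 p3 p2 c13 c12 c32 s132.
move=> [/edgeC e13|/edgeC e23] [/edgeC e12|e23'] [e12'|e13'].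
- by apply: path213 => //; apply: edgeC.
- by apply: path213 => //; apply: edgeC.
- exact: path123.
- by apply: path132 => //; apply: edgeC.
- exact: path123.
- exact: path123.
- exact: path123.
- by apply: path132 => //; apply: edgeC.
Qed.
End Frames.

(** * Products of a half-line and a Lorentz cone *)

Lemma small_step (R : realType) (x y : R) : 0 < x ->
  exists2 k, 0 < k & forall eps, 0 < eps -> eps <= k -> 0 <= x - eps * y.
Proof.
move=> x0; have y1 : 0 < `|y| + 1 by rewrite ltr_wpDl.
exists (x / (`|y| + 1)); first exact: divr_gt0.
move=> eps e0; rewrite ler_pdivlMr// => le.
have := ler_norm y; nra.
Qed.

Section Downdate.
Variables (R : realType) (V : vectType R) (dot : {dot V for (@idfun R)}).

Local Notation ts := (tensor_square dot).

(** Changing the vectors of a decomposition by multiples of [a], an element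
    of their span, changes the sum of their squares by a multiple of that of
    [a]. *)
Lemma tensor_square_downdate (I : Type) (r : seq I) (p : I -> V) (l : I -> R)
    k a :
  a = \sum_(i <- r) l i *: p i ->
  \sum_(i <- r) ts (p i - (k * l i) *: a) =
  \sum_(i <- r) ts (p i) -
    (2 * k - k ^+ 2 * \sum_(i <- r) l i ^+ 2) *: ts a.
Proof.
move=> aE; apply/lfunP => y; apply: (dot_inj (dot := dot)) => z.
rewrite add_lfunE opp_lfunE scale_lfunE !sum_lfunE tensor_squareE !dotE.
rewrite !dot_suml.
have az x : dot a x = \sum_(i <- r) l i * dot (p i) x.
  by rewrite aE dot_suml; apply: eq_bigr => i _; rewrite dotZl.
transitivity (\sum_(i <- r) dot (ts (p i) y) z
   - k * dot a z * (\sum_(i <- r) l i * dot (p i) y)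
   - k * dot a y * (\sum_(i <- r) l i * dot (p i) z)
   + k ^+ 2 * dot a y * dot a z * \sum_(i <- r) l i ^+ 2).
  rewrite !mulr_sumr -!sumrB -big_split; apply: eq_bigr => i _ /=.
  rewrite !tensor_squareE !dotE; ring.
rewrite -!az; ring.
Qed.

(** The two summands are the images of [a] and [b] under a rotation, scaled. *)
Lemma tensor_square_rotation a b t :
  ts a + ts b = (1 + t ^+ 2)^-1 *: (ts (a + t *: b) + ts (t *: a - b)).
Proof.
have t1 : 1 + t ^+ 2 != 0 by rewrite gt_eqF// ltr_wpDr ?sqr_ge0.
apply/lfunP => y; apply: (dot_inj (dot := dot)) => z.
by rewrite scale_lfunE !add_lfunE !tensor_squareE !dotE; field.
Qed.
End Downdate.

Section LorentzProduct.
Variables (R : realType) (V : vectType R) (dot : {dot V for (@idfun R)}).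
Variables (c e : V) (J : 'End(V)).
Hypothesis c0 : c != 0.
Hypothesis Jsa : self_adjoint dot J.
Hypothesis Jc : J c = 0.
Hypothesis ce : dot c e = 0.
(** The form of [J] is negative definite on the orthogonal of [e], modulo its
    kernel [c]. *)
Hypothesis Jneg : forall p, dot p e = 0 -> 0 <= dot p (J p) ->
  exists k, p = k *: c.

Implicit Types (a b p x y z u : V) (k t m : R).

Local Notation ts := (tensor_square dot).
Local Notation B x y := (dot x (J y)).

Definition lorentz_product : set V :=
  [set p | [/\ 0 <= dot p c, 0 <= dot p e & 0 <= B p p]].
Local Notation K := lorentz_product.
Local Notation CP := (completely_positive dot K).

Let BC x y : B x y = B y x.
Proof. by rewrite -Jsa dotC. Qed.

Let BDl x y z : B (x + y) z = B x z + B y z. Proof. exact: dotDl. Qed.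
Let BZl k x z : B (k *: x) z = k * B x z. Proof. exact: dotZl. Qed.
Let BDr x y z : B z (x + y) = B z x + B z y.
Proof. by rewrite linearD dotDr. Qed.
Let BZr k x z : B z (k *: x) = k * B z x.
Proof. by rewrite linearZ dotZr. Qed.
Let BNl x z : B (- x) z = - B x z. Proof. exact: dotNl. Qed.
Let BNr x z : B z (- x) = - B z x. Proof. by rewrite linearN dotNr. Qed.
Let Bcr x : B x c = 0. Proof. by rewrite Jc dot0r. Qed.
Let Bcl x : B c x = 0. Proof. by rewrite BC Bcr. Qed.
Let BE := (BDl, BDr, BZl, BZr, BNl, BNr, Bcl, Bcr).

(** Subtract the multiple of [x] that brings [y] into the orthogonal of [e]:
    there the form is negative semidefinite, but it is nonnegative at the
    difference when [B x y <= 0]. *)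
Lemma lorentz_proportional x y : 0 < dot x e -> 0 <= B x x ->
  0 <= dot y e -> 0 <= B y y -> B x y <= 0 ->
  exists k m, 0 <= k /\ y = k *: x + m *: c.
Proof.
move=> xe xx ye yy xy; pose k := dot y e / dot x e.
have k0 : 0 <= k by rewrite divr_ge0// ltW.
have [||m yE] := Jneg (p := y - k *: x).
- by rewrite !dotE /k mulfVK ?subrr// gt_eqF.
- rewrite !BE (BC y x); have := mulr_ge0 k0 (mulr_ge0 k0 xx); nra.
by exists k, m; rewrite -yE addrC subrK.
Qed.

Lemma lorentz_form_ge0 x y : 0 <= dot x e -> 0 <= B x x ->
  0 <= dot y e -> 0 <= B y y -> 0 <= B x y.
Proof.
rewrite le0r => /predU1P[/Jneg xc /xc[k ->] _ _|xe xx ye yy].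
  by rewrite !BE mulr0.
rewrite leNgt; apply/negP => xy.
have [k [m [k0 yE]]] := lorentz_proportional xe xx ye yy (ltW xy).
by move: xy; rewrite yE !BE; have := mulr_ge0 k0 xx; lra.
Qed.

(** Reversed Cauchy-Schwarz: a timelike [x] separates the two halves of the set
    where the form is nonnegative. *)
Lemma lorentz_same_side x y : 0 <= dot x e -> 0 < B x x ->
  0 <= B y y -> 0 <= B x y -> 0 <= dot y e.
Proof.
move=> xe xx yy xy; rewrite leNgt; apply/negP => ye.
have xe0 : 0 < dot x e.
  rewrite lt0r xe andbT; apply: contraTneq xx => /Jneg xc; rewrite -leNgt.
  by rewrite leNgt; apply/negP => xx; have [k xE] := xc (ltW xx); move: xx;
    rewrite xE !BE; lra.
have [|||k [m [k0 yE]]] := @lorentz_proportional x (- y) xe0 (ltW xx).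
- by rewrite dotNl; lra.
- by rewrite !BE; lra.
- by rewrite !BE; lra.
have : B x (- y) = k * B x x by rewrite yE !BE; lra.
have : dot (- y) e = k * dot x e by rewrite yE !dotE ce; lra.
rewrite BNr dotNl => ye' xy'; nra.
Qed.

Lemma lorentz_product0 : K 0.
Proof. by split; rewrite !dot0l. Qed.

Lemma lorentz_product_cone : is_cone K.
Proof.
move=> k x k0 [xc xe xx]; split; rewrite ?dotE ?mulr_ge0//.
by rewrite !BE !mulr_ge0.
Qed.

Lemma lorentz_product_or_opp a : dot a c = 0 -> 0 <= B a a -> CP (ts a).
Proof.
move=> ac aa; wlog ae : a ac aa / 0 <= dot a e.
  move=> IH; have [|ae] := leP 0 (dot a e); first exact: IH.
  by rewrite -tensor_squareN; apply: IH; rewrite ?dotNl ?BE; lra.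
by apply: completely_positive_tensor; [exact: lorentz_product0|split;
  rewrite ?ac].
Qed.

(** [t] is the larger root of a quadratic equation; the second equation locates
    it relative to [B a b]. *)
Lemma isotropic_rotation a b : 0 <= B a a -> B b b < 0 ->
  exists2 t, B (a + t *: b) (a + t *: b) = 0 &
             - B b b * t = B a b + Num.sqrt (B a b ^+ 2 - B a a * B b b).
Proof.
move=> aa bb; have m0 : - B b b != 0 by rewrite oppr_eq0 lt_eqF.
set q := Num.sqrt _; exists ((B a b + q) / - B b b); last by field;
  rewrite lt_eqF.
have q2 : q ^+ 2 = B a b ^+ 2 - B a a * B b b by rewrite sqr_sqrtr//; nra.
set t := _ / _; have tE : - B b b * t = B a b + q by rewrite /t; field;
  rewrite lt_eqF.
rewrite !BE (BC b a); apply: (mulfI m0); rewrite mulr0.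
transitivity (- B b b * B a a + 2 * B a b * (- B b b * t) - (- B b b * t) ^+ 2).
  by ring.
by rewrite tE; move: q2; lra.
Qed.

Lemma rotation_complement_form a b t : B (a + t *: b) (a + t *: b) = 0 ->
  B (t *: a - b) (t *: a - b) = (1 + t ^+ 2) * (B a a + B b b).
Proof. by rewrite !BE (BC b a); lra. Qed.

(** Rotating [u] and [b] makes both isotropic; the choice of the sign of [b]
    keeps both on the side of [u]. *)
Lemma balanced_pair u b : 0 <= dot u c -> 0 <= dot u e -> dot b c = 0 ->
  0 < B u u -> B u u + B b b = 0 -> CP (ts u + ts b).
Proof.
move=> uc ue bc uu ub0; wlog ub : b bc ub0 / 0 <= B u b.
  move=> IH; have [|ub] := leP 0 (B u b); first exact: IH.
  by rewrite -(tensor_squareN _ b); apply: IH; rewrite ?dotNl ?bc ?oppr0 ?BE;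
    lra.
have bb : B b b < 0 by lra.
have [t iso tE] := isotropic_rotation (ltW uu) bb.
have iso' := rotation_complement_form iso; rewrite ub0 mulr0 in iso'.
have q0 := sqrtr_ge0 (B u b ^+ 2 - B u u * B b b).
have t0 : 0 <= t by rewrite -(pmulr_rge0 t (_ : 0 < - B b b)); lra.
have tub := mulr_ge0 t0 ub.
rewrite (tensor_square_rotation _ _ _ t).
apply: completely_positiveZ;
  [exact: lorentz_product0|exact: lorentz_product_cone|..].
  by rewrite invr_ge0 addr_ge0 ?sqr_ge0.
apply: completely_positiveD; first exact: lorentz_product0.
  apply: completely_positive_tensor; first exact: lorentz_product0.
  split; [by rewrite !dotE bc mulr0 addr0| |by rewrite iso].
  by apply: (lorentz_same_side ue uu); rewrite ?iso// !BE; lra.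
apply: completely_positive_tensor; first exact: lorentz_product0.
split; [by rewrite !dotE bc oppr0 addr0 mulr_ge0| |by rewrite iso'].
apply: (lorentz_same_side ue uu); rewrite ?iso'// !BE.
have -> : B u u = - B b b by lra.
lra.
Qed.

(** Vectors on which the form is negative are absorbed one at a time: by a
    multiple of [u] if the form is large enough at [u], and else by some other
    vector on which the form is positive. *)
Lemma completely_positive_absorb u (s : seq V) :
  0 <= dot u c -> 0 <= dot u e -> 0 <= B u u ->
  {in s, forall p, dot p c = 0} -> 0 <= B u u + \sum_(p <- s) B p p ->
  CP (ts u + \sum_(p <- s) ts p).
Proof.
have K0 := lorentz_product0; have KZ := lorentz_product_cone.
have CPD := @completely_positiveD _ _ dot K K0.
have [n] := ubnP (size s); elim: n u s => // n IHn u s sn uc ue uu sc.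
have [neg|] := boolP (has (fun b => B b b < 0) s); last first.
  rewrite -all_predC => /allP pos _; apply: (CPD).
    exact: completely_positive_tensor.
  rewrite big_seq; apply: (big_ind CP) => [||p ps];
    first exact: completely_positive0.
    exact: CPD.
  by apply: lorentz_product_or_opp; [exact: sc|rewrite leNgt; apply: pos].
have [b bs bb] := hasP neg.
have sb := perm_to_rem bs.
rewrite !(perm_big _ sb) !big_cons /= => sum0.
have {}sc : {in b :: rem b s, forall p, dot p c = 0}.
  by move=> p; rewrite -(perm_mem sb); apply: sc.
have bc : dot b c = 0 by apply: sc; rewrite mem_head.
have rc p : p \in rem b s -> dot p c = 0 by move=> pr; apply: sc;
  rewrite inE pr orbT.
have {}sn : (size (rem b s) < n)%N.
  by rewrite -ltnS (leq_trans _ sn)// (perm_size sb).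
move: (rem b s) sum0 sn rc => {sc sb neg bs}r sum0 rn rc.
have [le|lt] := leP (- B b b) (B u u).
  pose k := - B b b / B u u.
  have uu0 : 0 < B u u by lra.
  have kE : k * B u u = - B b b by rewrite mulfVK// gt_eqF.
  have k0 : 0 <= k by rewrite divr_ge0//; lra.
  have k1 : 0 <= 1 - k by rewrite subr_ge0 ler_pdivrMr// mul1r.
  have -> : ts u = ts (Num.sqrt k *: u) + ts (Num.sqrt (1 - k) *: u).
    by rewrite !tensor_squareZ !sqr_sqrtr// -scalerDl addrC subrK scale1r.
  rewrite addrACA; apply: (CPD).
    apply: balanced_pair; rewrite ?dotZl ?mulr_ge0 ?sqrtr_ge0//.
      by rewrite !BE mulrA -expr2 sqr_sqrtr// kE; lra.
    by rewrite !BE mulrA -expr2 sqr_sqrtr// kE; lra.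
  apply: IHn => //; rewrite ?dotZl ?mulr_ge0 ?sqrtr_ge0//.
    by rewrite !BE !mulr_ge0 ?sqrtr_ge0.
  by rewrite !BE mulrA -expr2 sqr_sqrtr// mulrBl mul1r kE; lra.
have /hasP[a ar aa] : has (fun a => 0 < B a a) r.
  apply: contraTT sum0; rewrite -all_predC => /allP npos; rewrite -ltNge.
  have : \sum_(p <- r) B p p <= 0.
    by rewrite big_seq sumr_le0// => p /npos /=; rewrite -leNgt.
  lra.
have ra := perm_to_rem ar.
rewrite (perm_big _ ra) big_cons /= in sum0;
  rewrite (perm_big _ ra) big_cons /=.
have ac : dot a c = 0 by apply: rc.
have {}rn : (size (rem a r) < n.-1)%N.
  by rewrite ltn_predRL (leq_ltn_trans _ rn)// (perm_size ra).
have {}rc p : p \in rem a r -> dot p c = 0.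
  by move=> pr; apply: rc; rewrite (perm_mem ra) inE pr orbT.
move: (rem a r) sum0 rn rc => {r ra ar}r sum0 rn rc.
have [t iso _] := isotropic_rotation (ltW aa) bb.
have iso' := rotation_complement_form iso.
have t1 : 0 < 1 + t ^+ 2 by rewrite ltr_wpDr ?sqr_ge0.
pose q := Num.sqrt (1 + t ^+ 2)^-1.
have q2 : q ^+ 2 = (1 + t ^+ 2)^-1 by rewrite sqr_sqrtr// invr_ge0 ltW.
have -> : ts u + (ts b + (ts a + \sum_(p <- r) ts p)) =
    ts (q *: (a + t *: b)) +
    (ts u + \sum_(p <- (q *: (t *: a - b)) :: r) ts p).
  rewrite big_cons [RHS]addrCA; congr (_ + _); rewrite !addrA; congr (_ + _).
  by rewrite addrC (tensor_square_rotation _ _ _ t) !tensor_squareZ q2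
    -scalerDr.
apply: (CPD).
  apply: lorentz_product_or_opp; last by rewrite BZl BZr iso !mulr0.
  by rewrite !dotE ac bc mulr0 addr0 mulr0.
apply: IHn => //.
- by rewrite /= -ltn_predRL.
- move=> p; rewrite inE => /predU1P[->|/rc//].
  by rewrite !dotE ac bc mulr0 subr0 mulr0.
rewrite big_cons BZl BZr iso' mulrA -expr2 q2 mulKf ?gt_eqF//; lra.
Qed.

(** These are the conditions that are immediate for elements of [CP]. The
    vector [f c] is normalized to [u], whose square carries the whole
    coordinate along [c]; what remains is a sum of squares of vectors
    orthogonal to [c]. *)
Lemma completely_positive_lorentz_product (s : seq V)
    (f := \sum_(p <- s) ts p) :
  0 <= trace_form f J -> 0 <= dot (f c) e -> 0 <= B (f c) (f c) -> CP f.
Proof.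
have formE (r : seq V) :
    trace_form (\sum_(p <- r) ts p) J = \sum_(p <- r) B p p.
  by rewrite trace_form_suml; apply: eq_bigr => p _;
    rewrite trace_form_tensor_square.
have fc : f c = \sum_(p <- s) dot p c *: p.
  by rewrite sum_lfunE; apply: eq_bigr => p _; rewrite tensor_squareE.
move=> tr fce fcc.
pose N := \sum_(p <- s) dot p c ^+ 2.
have N0 : 0 <= N by apply: sumr_ge0 => p _; exact: sqr_ge0.
have [Nz|Nn0] := eqVneq N 0.
  have sc : {in s, forall p, dot p c = 0}.
    move=> p ps; apply/eqP; rewrite -sqrf_eq0; apply/eqP.
    by apply: (psumr_seq_eq0 _ Nz) => // q _; exact: sqr_ge0.
  have := @completely_positive_absorb 0 s; rewrite tensor_square0 add0r;
    apply=> //.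
  - by rewrite dot0l.
  - by rewrite dot0l.
  - by rewrite dot0l.
  by rewrite dot0l add0r -formE.
have Ngt0 : 0 < N by rewrite lt0r Nn0.
pose q := (Num.sqrt N)^-1.
have q0 : 0 < q by rewrite invr_gt0 sqrtr_gt0.
have q2 : q ^+ 2 * N = 1 by rewrite exprVn sqr_sqrtr// mulVf.
pose u := q *: f c.
have uE : u = \sum_(p <- s) (q * dot p c) *: p.
  by rewrite /u fc scaler_sumr; apply: eq_bigr => p _; rewrite scalerA.
have fcc' : dot (f c) c = N.
  by rewrite fc dot_suml; apply: eq_bigr => p _; rewrite dotZl.
have := tensor_square_downdate dot 1 uE.
under eq_bigr do rewrite mul1r.
have -> : \sum_(p <- s) (q * dot p c) ^+ 2 = 1.
  by rewrite -q2 mulr_sumr; apply: eq_bigr => p _; rewrite exprMn.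
rewrite expr1n !mulr1 (_ : 2 - 1 = 1) ?scale1r; last by ring.
rewrite -/f; set r := [seq p - (q * dot p c) *: u | p <- s] => fE.
have {}fE : f = ts u + \sum_(p <- r) ts p by rewrite big_map fE addrC subrK.
rewrite fE; apply: completely_positive_absorb.
- by rewrite dotZl fcc' mulr_ge0// ltW.
- by rewrite dotZl mulr_ge0// ltW.
- by rewrite BZl BZr !mulr_ge0// ltW.
- move=> _ /mapP[p _ ->]; rewrite !dotE fcc'.
  have -> : q * dot p c * (q * N) = q ^+ 2 * N * dot p c by ring.
  by rewrite q2 mul1r subrr.
by rewrite -formE -trace_form_tensor_square -trace_formDl -fE.
Qed.
Local Notation dualCP := (dual_cone (self_adjoint dot) trace_form CP).

Let dual_tensor_square (r : seq V) : dualCP (\sum_(b <- r) ts b).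
Proof.
apply/(dual_completely_positiveP _ lorentz_product0); split.
  by apply: self_adjoint_sum => b; exact: tensor_square_self_adjoint.
move=> a _; rewrite sum_lfunE dot_sumr sumr_ge0// => b _.
by rewrite tensor_squareE dotZr (dotC _ a b) -expr2 sqr_ge0.
Qed.

(** The positive semidefinite form with kernel the range of [f] exposes the
    vectors whose square can be subtracted from [f]. *)
Lemma expose_range (s : seq V) (f := \sum_(p <- s) ts p) : exists d,
  [/\ dualCP d, trace_form f d = 0 & forall a, dot a (d a) = 0 ->
   exists2 k, 0 < k & forall eps, 0 < eps -> eps <= k ->
   exists r, f - eps *: ts a = \sum_(p <- r) ts p].
Proof.
pose b := vbasis (lker f).
have bP x : x \in lker f -> {in s, forall p, dot p x = 0}.
  rewrite memv_ker => /eqP /(congr1 (dot x)).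
  rewrite dot0r sum_lfunE dot_sumr => sum0 p ps.
  have := psumr_seq_eq0 _ sum0 ps => /(_ _)/eqP.
  rewrite tensor_squareE dotZr (dotC _ x p) mulf_eq0 orbb => eq0.
  apply/eqP/eq0 => q _; rewrite tensor_squareE dotZr (dotC _ x q).
  by rewrite -expr2 sqr_ge0.
exists (\sum_(y <- b) ts y); split; first exact: dual_tensor_square.
  rewrite trace_form_suml big_seq big1// => p ps.
  rewrite trace_form_tensor_square sum_lfunE dot_sumr big_seq big1// => y yb.
  by rewrite tensor_squareE dotZr (dotC _ y) (bP y)// ?mul0r ?vbasis_mem.
move=> a; rewrite sum_lfunE dot_sumr => sum0.
have ab : {in b, forall y, dot y a = 0}.
  move=> y yb; have := psumr_seq_eq0 _ sum0 yb => /(_ _)/eqP.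
  rewrite tensor_squareE dotZr (dotC _ a y) mulf_eq0 orbb => eq0.
  apply/eqP/eq0 => q _; rewrite tensor_squareE dotZr (dotC _ a q).
  by rewrite -expr2 sqr_ge0.
have aspan : a \in <<s>>%VS.
  apply: (mem_span_orthogonal (dot := dot)) => y sy.
  have yf : y \in lker f.
    rewrite memv_ker sum_lfunE big_seq big1// => p ps.
    by rewrite tensor_squareE sy// scale0r.
  rewrite (coord_vbasis yf) dot_suml big1// => i _.
  by rewrite dotZl ab ?mulr0// mem_nth// size_tuple.
pose l i : R := coord (in_tuple s) i a.
have aE : a = \sum_i l i *: (in_tuple s)`_i := coord_span (X := in_tuple s)
  aspan.
pose L := \sum_i l i ^+ 2.
have L0 : 0 <= L by apply: sumr_ge0 => i _; exact: sqr_ge0.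
pose k := (L + 1)^-1.
have k0 : 0 < k by rewrite invr_gt0; lra.
have kL : k * L = 1 - k by rewrite /k; field; lra.
exists (2 * k - k ^+ 2 * L) => [|eps e0 ek].
  have -> : 2 * k - k ^+ 2 * L = k * (1 + k).
    by rewrite expr2 -mulrA kL; ring.
  by rewrite mulr_gt0//; lra.
have := tensor_square_downdate dot k aE; rewrite -/L.
have -> : \sum_(i < size s) ts (in_tuple s)`_i = f.
  by rewrite /f (big_nth 0) big_mkord.
set r := map (fun i : 'I_(size s) => (in_tuple s)`_i - (k * l i) *: a)
  (index_enum _).
move=> fE; exists (Num.sqrt (2 * k - k ^+ 2 * L - eps) *: a :: r).
rewrite big_cons tensor_squareZ sqr_sqrtr ?subr_ge0// big_map fE.
by rewrite scalerBl [RHS]addrC addrA subrK.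
Qed.

Lemma expose_trace f : CP f -> exists d,
  [/\ dualCP d, trace_form f d = 0 & forall a, K a -> dot a (d a) = 0 ->
   exists2 k, 0 < k & forall eps, 0 < eps -> eps <= k ->
   0 <= trace_form (f - eps *: ts a) J].
Proof.
have dJ : dualCP J.
  by apply/(dual_completely_positiveP _ lorentz_product0); split=> // a [].
move=> Cf; have := dJ.2 f Cf; rewrite le0r => /predU1P[tr0|tr].
  exists J; split=> // a _ aa; exists 1 => // eps e0 _.
  rewrite trace_formDl -scaleNr trace_formZl trace_form_tensor_square aa tr0.
  by rewrite mulr0 addr0.
exists 0; split=> [||a Ka _].
- by have := dual_tensor_square nil; rewrite big_nil.
- exact: trace_form0r.
have [k k0 kP] := small_step (B a a) tr.
exists k => // eps e0 ek.
by rewrite trace_formDl -scaleNr trace_formZl trace_form_tensor_square mulNr kP.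
Qed.
(** Modulo [c], the vector [f c] lies in the Lorentz cone; the exposing form
    multiplies the coordinate along [c] by a functional that supports this cone
    at [f c]. *)
Lemma expose_corner f : CP f -> exists d,
  [/\ dualCP d, trace_form f d = 0 & forall a, K a -> dot a (d a) = 0 ->
   exists2 k, 0 < k & forall eps, 0 < eps -> eps <= k ->
   let z := (f - eps *: ts a) c in 0 <= dot z e /\ 0 <= B z z].
Proof.
move=> /(completely_positiveP _ lorentz_product0)[s Ks fE].
pose D w : 'End(V) := ts (c + w) - ts c - ts w.
have DE w a : dot a (D w a) = 2 * dot a c * dot a w.
  rewrite /D !add_lfunE !opp_lfunE !tensor_squareE !dotE.
  by rewrite (dotC _ c a) (dotC _ w a); ring.
have dual w : (forall a, K a -> 0 <= dot a w) -> dualCP (D w).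
  move=> w0; apply/(dual_completely_positiveP _ lorentz_product0); split.
    move=> x y; have sa v : dot (ts v x) y = dot x (ts v y).
      exact: tensor_square_self_adjoint.
    by rewrite /D !add_lfunE !opp_lfunE !dotE !sa.
  by move=> a Ka; rewrite DE !mulr_ge0 ?w0//; case: Ka.
have fc : f c = \sum_(a <- s) dot a c *: a.
  by rewrite fE sum_lfunE; apply: eq_bigr => a _; rewrite tensor_squareE.
have trD w : trace_form f (D w) = 2 * dot (f c) w.
  rewrite fE trace_form_suml -fE fc dot_suml mulr_sumr; apply: eq_bigr => a _.
  by rewrite trace_form_tensor_square DE dotZl mulrA.
set z := f c.
have [ze zz] : 0 <= dot z e /\ 0 <= B z z.
  split; rewrite {1}/z fc dot_suml big_seq; apply: sumr_ge0 => a /Ks[ac ae aa].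
    by rewrite dotZl mulr_ge0.
  rewrite dotZl mulr_ge0// BC /z fc dot_suml big_seq.
  apply: sumr_ge0 => b /Ks[bc be bb].
  by rewrite dotZl mulr_ge0// lorentz_form_ge0.
have step eps a : (f - eps *: ts a) c = z - (eps * dot a c) *: a.
  by rewrite add_lfunE opp_lfunE scale_lfunE tensor_squareE scalerA.
have [ze0|ze0] := eqVneq (dot z e) 0.
  (* [f c] is the apex of the Lorentz cone, exposed by the interior functional
     [e] of the dual cone. *)
  have [m zE] := Jneg ze0 zz.
  exists (D e); split; first by apply: dual => a [].
    by rewrite trD ze0 mulr0.
  move=> a [_ _ aa]; rewrite DE => /eqP; rewrite -mulrA mulf_eq0 pnatr_eq0 /=.
  move=> /eqP ace.
  exists 1 => // eps e0 _; rewrite step /=; split.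
    by rewrite !dotE ze0 -mulrA ace mulr0 oppr0 addr0.
  rewrite zE; have := mulr_ge0 (sqr_ge0 (eps * dot a c)) aa.
  by rewrite !BE; lra.
have {}ze0 : 0 < dot z e by rewrite lt0r ze0.
move: zz; rewrite le0r => /predU1P[zz|zz].
  (* On the boundary, away from the apex, the supporting functional is the
     tangent one. *)
  exists (D (J z)); split.
  - by apply: dual => a [_ ae aa]; apply: lorentz_form_ge0 => //; rewrite zz.
  - by rewrite trD zz mulr0.
  move=> a [ac ae aa]; rewrite DE => /eqP; rewrite -mulrA mulf_eq0 pnatr_eq0 /=.
  rewrite mulf_eq0 => /orP[/eqP ac0|/eqP az].
    exists 1 => // eps e0 _; rewrite step ac0 mulr0 scale0r subr0 /=.
    by rewrite zz; split; first exact: ltW.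
  have [||k [m [k0 aE]]] := lorentz_proportional ze0 _ ae aa;
    first by rewrite zz.
    by rewrite BC az.
  have [r r0 rP] := small_step (dot a c * k) (ltr01 : 0 < 1 :> R).
  exists r => // eps e0 /(rP _ e0) rk.
  have -> : (f - eps *: ts a) c =
      (1 - eps * (dot a c * k)) *: z - (eps * dot a c * m) *: c.
    rewrite step; move: (dot a c) => t; rewrite aE.
    by apply: (dot_inj (dot := dot)) => y; rewrite !dotE; ring.
  split; rewrite /=.
    by rewrite !dotE ce mulr0 oppr0 addr0 mulr_ge0.
  by rewrite !BE zz !mulr0 oppr0 addr0.
exists 0; split=> [||a [ac ae aa] _].
- by have := dual_tensor_square nil; rewrite big_nil.
- exact: trace_form0r.
have [r r0 rP] := small_step (dot a c * dot a e) ze0.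
have [q q0 qP] := small_step (2 * dot a c * B z a) zz.
exists (Num.min r q) => [|eps e0]; first by rewrite lt_min r0.
rewrite le_min => /andP[/(rP _ e0) er /(qP _ e0) eq]; rewrite step /=; split.
  by rewrite !dotE -mulrA.
rewrite !BE (BC a z); have := mulr_ge0 (sqr_ge0 (eps * dot a c)) aa.
move: eq; lra.
Qed.

Theorem lorentz_product_facially_exposed :
  facially_exposed (self_adjoint dot) trace_form CP.
Proof.
apply: completely_positive_facially_exposed.
- exact: lorentz_product0.
- exact: lorentz_product_cone.
move=> f Cf; have [s Ks fE] := (completely_positiveP _ lorentz_product0 f).1 Cf.
have [d1 [[s1 p1] t1 h1]] := expose_range s.
have [d2 [[s2 p2] t2 h2]] := expose_trace Cf.
have [d3 [[s3 p3] t3 h3]] := expose_corner Cf.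
exists (d1 + (d2 + d3)); split.
- split=> [x y|g Cg];
  first by rewrite !add_lfunE !dotE (s1 x y) (s2 x y) (s3 x y).
  by rewrite !trace_formDr !addr_ge0 ?p1 ?p2 ?p3.
- by rewrite !trace_formDr t2 t3 {1}fE t1 !addr0.
move=> a Ka; rewrite !add_lfunE !dotE => sum0.
have Ca := completely_positive_tensor dot lorentz_product0 Ka.
have := p1 _ Ca; have := p2 _ Ca; have := p3 _ Ca.
rewrite !trace_form_tensor_square => g3 g2 g1.
have [k1 k10 h1a] := h1 a ltac:(lra).
have [k2 k20 h2a] := h2 a Ka ltac:(lra).
have [k3 k30 h3a] := h3 a Ka ltac:(lra).
exists (Num.min k1 (Num.min k2 k3)); first by rewrite !lt_min k10 k20.
set k := Num.min _ _.
have k0 : 0 < k by rewrite !lt_min k10 k20.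
have [le1 [le2 le3]] : k <= k1 /\ k <= k2 /\ k <= k3.
  by rewrite /k !ge_min !lexx !orbT.
have [r rE] := h1a k k0 le1; have := h2a k k0 le2; have := h3a k k0 le3.
rewrite fE rE => -[ze zz] tr; exact: completely_positive_lorentz_product.
Qed.
End LorentzProduct.

(** * The cone of squares of a split algebra *)

Section SplitAlgebra.
Variables (R : realType) (E : ejaType R).
Implicit Types (u v x y z : E).

Local Notation "x ** y" := (jmul x y).
Local Notation "''<' x , y >" := (jdot x y).
Local Notation h := (2^-1 : R).
Local Notation ts := (tensor_square (@jdot R E)).

Section Isolated.
Variables c1 c2 c3 : E.
Hypotheses (p1 : primitive_idempotent c1) (p2 : primitive_idempotent c2)
  (p3 : primitive_idempotent c3).
Hypotheses (c12 : c1 ** c2 = 0) (c13 : c1 ** c3 = 0) (c23 : c2 ** c3 = 0).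
Hypothesis sum_c : c1 + c2 + c3 = jone.
Hypothesis isolated : forall v, c1 ** v = h *: v -> v = 0.

Let c11 : c1 ** c1 = c1. Proof. by case: p1. Qed.
Let c22 : c2 ** c2 = c2. Proof. by case: p2. Qed.
Let c33 : c3 ** c3 = c3. Proof. by case: p3. Qed.

Let c31 : c3 ** c1 = 0. Proof. by rewrite jmulC. Qed.
Let c21 : c2 ** c1 = 0. Proof. by rewrite jmulC. Qed.

(** Peirce decomposition for [c1], then for [c2]; the components along [c1] with
    eigenvalue [1/2] vanish because [c1] is isolated. *)
Lemma split_decomposition x : exists a b g u,
  [/\ x = a *: c1 + b *: c2 + g *: c3 + u, c1 ** u = 0, c2 ** u = h *: u &
      c3 ** u = h *: u].
Proof.
have [a xa] := primitive_peirce1 p1 (peirce1P c11 x).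
have [y c1y xE] : exists2 y, c1 ** y = 0 & x = a *: c1 + y.
  exists (peirce0 c1 x); first exact: peirce0P.
  by rewrite {1}(peirce_decomposition c1 x) (isolated (peirce_halfP c11 x))
    addr0 xa.
have [b yb] := primitive_peirce1 p2 (peirce1P c22 y).
have c1c2 z : c1 ** (c2 ** z) = c2 ** (c1 ** z) by rewrite (peirce0_commutes
  c22).
set u := peirce_half c2 y; set g := peirce0 c2 y.
have c1u : c1 ** u = 0 by rewrite /u /peirce_half !jmulE !c1c2 c1y !jmulE
  !(oppr0, addr0, scaler0).
have c1g : c1 ** g = 0 by rewrite /g /peirce0 !jmulE !c1c2 c1y !jmulE !(oppr0,
  addr0, scaler0).
have c2g : c2 ** g = 0 := peirce0P c22 y.
have c2u : c2 ** u = h *: u := peirce_halfP c22 y.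
have c3g : c3 ** g = g by rewrite -[RHS]jmul1x -sum_c !jmulDl c1g c2g !add0r.
have c3u : c3 ** u = h *: u.
  have := jmul1x u; rewrite -sum_c !jmulDl c1u c2u add0r => e.
  by apply: (dot_inj (dot := jdot)) => t; have := congr1 (jdot^~ t) e;
    rewrite !dotE; lra.
have [k gk] := primitive_peirce1 p3 c3g.
exists a, b, k, u; split=> //.
rewrite xE [y in LHS](peirce_decomposition c2) yb -/u -/g gk.
by rewrite -!addrA; congr (_ + (_ + _)); rewrite addrC.
Qed.

Local Notation n1 := '<c1, c1>.
Local Notation n2 := '<c2, c2>.
Local Notation n3 := '<c3, c3>.

Let n1_gt0 : 0 < n1. Proof. by case: p1 => c0 _ _; apply: dot_gt0. Qed.
Let n2_gt0 : 0 < n2. Proof. by case: p2 => c0 _ _; apply: dot_gt0. Qed.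
Let n3_gt0 : 0 < n3. Proof. by case: p3 => c0 _ _; apply: dot_gt0. Qed.

Let d12 : '<c1, c2> = 0. Proof. exact: orthogonal_idempotents_dot. Qed.
Let d13 : '<c1, c3> = 0. Proof. exact: orthogonal_idempotents_dot. Qed.
Let d23 : '<c2, c3> = 0. Proof. exact: orthogonal_idempotents_dot. Qed.

(** The functional [b + g] at [a c1 + b c2 + g c3 + u]. *)
Definition split_time : E := n2^-1 *: c2 + n3^-1 *: c3.

(** Its quadratic form is [b g - |u|^2 / (2 n2)] at [a c1 + b c2 + g c3 + u]. *)
Definition split_form : 'End(E) :=
  (2 * n2 * n3)^-1 *: (ts (c2 + c3) - ts c2 - ts c3)
  - (2 * n2)^-1 *: (\1%VF - n1^-1 *: ts c1 - n2^-1 *: ts c2 - n3^-1 *: ts c3).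

Lemma split_formE x y : '<x, split_form y> =
  ('<x, c2> * '<y, c3> + '<x, c3> * '<y, c2>) / (2 * n2 * n3)
  - ('<x, y> - '<x, c1> * '<y, c1> / n1 - '<x, c2> * '<y, c2> / n2
     - '<x, c3> * '<y, c3> / n3) / (2 * n2).
Proof.
rewrite /split_form !(add_lfunE, opp_lfunE, scale_lfunE, id_lfunE)
  !tensor_squareE.
rewrite !dotE (dotC _ y c1) (dotC _ y c2) (dotC _ y c3).
by field; rewrite !gt_eqF.
Qed.

Lemma split_coordinates a b g u : c1 ** u = 0 -> c2 ** u = h *: u ->
  c3 ** u = h *: u -> let x := a *: c1 + b *: c2 + g *: c3 + u in
  [/\ '<x, c1> = a * n1, '<x, c2> = b * n2, '<x, c3> = g * n3 &
      '<x, x> = a ^+ 2 * n1 + b ^+ 2 * n2 + g ^+ 2 * n3 + '<u, u> ].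
Proof.
move=> c1u c2u c3u x.
have u1 : '<u, c1> = 0 by rewrite -{1}c11 -jdotA (jmulC u) c1u dot0l.
have u2 : '<u, c2> = 0.
  have : '<u, c2> = h * '<u, c2> by rewrite -{1}c22 -jdotA (jmulC u) c2u dotZl.
  lra.
have u3 : '<u, c3> = 0.
  have : '<u, c3> = h * '<u, c3> by rewrite -{1}c33 -jdotA (jmulC u) c3u dotZl.
  lra.
rewrite /x; split;
  rewrite !dotE ?(dotC _ c2 c1) ?(dotC _ c3 c1) ?(dotC _ c3 c2);
  rewrite ?(dotC _ c1 u) ?(dotC _ c2 u) ?(dotC _ c3 u) ?u1 ?u2 ?u3 ?d12 ?d13
    ?d23;
  ring.
Qed.

Let time_coordinate a b g u : c1 ** u = 0 -> c2 ** u = h *: u ->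
  c3 ** u = h *: u -> '<a *: c1 + b *: c2 + g *: c3 + u, split_time> = b + g.
Proof.
move=> c1u c2u c3u; have [_ x2 x3 _] := split_coordinates a b g c1u c2u c3u.
by rewrite !(dotDr _ _ _ _) !(dotZr _ _ _) x2 x3; field; rewrite !gt_eqF.
Qed.

Let form_coordinate a b g u : c1 ** u = 0 -> c2 ** u = h *: u ->
  c3 ** u = h *: u -> let x := a *: c1 + b *: c2 + g *: c3 + u in
  '<x, split_form x> = b * g - '<u, u> / (2 * n2).
Proof.
move=> c1u c2u c3u x; have [x1 x2 x3 xx] := split_coordinates a b g c1u c2u c3u.
rewrite split_formE x1 x2 x3 xx; field; by rewrite !gt_eqF.
Qed.

Let spin_square u : c2 ** u = h *: u -> c3 ** u = h *: u ->
  u ** u = ('<u, u> / (2 * n2)) *: (c2 + c3).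
Proof.
move=> c2u c3u; have [a [-> a2 _]] := peirce12_square p2 p3 c23 c2u c3u.
by congr (_ *: _); rewrite invfM mulrA (mulrC '<u, u>) a2 mulfK// gt_eqF.
Qed.

Let spin_eq0 u : '<u, u> / (2 * n2) = 0 -> u = 0.
Proof.
move=> q0; have n2' : 2 * n2 != 0 by rewrite mulf_neq0// gt_eqF.
by apply: (dot_eq0 (dot := jdot)); rewrite -(divfK n2' '<u, u>) q0 mul0r.
Qed.

Let split_square a b g u : c1 ** u = 0 -> c2 ** u = h *: u ->
  c3 ** u = h *: u -> let q := '<u, u> / (2 * n2) in
  let x := a *: c1 + b *: c2 + g *: c3 + u in
  x ** x = (a ^+ 2) *: c1 + (b ^+ 2 + q) *: c2 + (g ^+ 2 + q) *: c3
           + (b + g) *: u.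
Proof.
move=> c1u c2u c3u q x; have uu := spin_square c2u c3u; rewrite -/q in uu.
rewrite /x !(jmulDl, jmulDr) !(jmulZl, jmulZr) c11 c22 c33 c12 c13 c23 c21 c31.
rewrite (jmulC c3 c2) c23 !(jmulC u _) c1u c2u c3u uu.
by apply: (dot_inj (dot := jdot)) => t; rewrite !dotE; field.
Qed.

Lemma split_square_cone :
  square_cone E = lorentz_product jdot c1 split_time split_form.
Proof.
apply/seteqP; split=> x.
  move=> [y ->]; have [a [b [g [u [-> c1u c2u c3u]]]]] := split_decomposition y.
  rewrite split_square//; set q := _ / _; set k := b + g.
  have [c1k c2k c3k] : [/\ c1 ** (k *: u) = 0, c2 ** (k *: u) = h *: (k *: u)
                        & c3 ** (k *: u) = h *: (k *: u)].
    by rewrite !jmulZr c1u c2u c3u scaler0 !scalerA mulrC.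
  have q0 : 0 <= q by rewrite divr_ge0 ?dot_ge0// mulr_ge0// ltW.
  have [x1 _ _ _] := split_coordinates (a ^+ 2) (b ^+ 2 + q) (g ^+ 2 + q) c1k
    c2k c3k.
  split; first by rewrite x1 mulr_ge0 ?sqr_ge0// ltW.
    by rewrite time_coordinate// !addr_ge0 ?sqr_ge0.
  rewrite form_coordinate// !dotE.
  have -> : k * (k * '<u, u>) / (2 * n2) = k ^+ 2 * q by rewrite /q; ring.
  have -> : (b ^+ 2 + q) * (g ^+ 2 + q) - k ^+ 2 * q = (b * g - q) ^+ 2.
    by rewrite /k; ring.
  exact: sqr_ge0.
have [a [b [g [u [-> c1u c2u c3u]]]]] := split_decomposition x.
have [x1 _ _ _] := split_coordinates a b g c1u c2u c3u.
move=> [+ + +];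
  rewrite x1 time_coordinate// form_coordinate// (pmulr_lge0 _ n1_gt0).
set q := _ / _ => a0 bg0 det0.
have q0 : 0 <= q by rewrite divr_ge0 ?dot_ge0// mulr_ge0// ltW.
pose r := Num.sqrt (b * g - q).
have r0 : 0 <= r by exact: sqrtr_ge0.
have r2 : r ^+ 2 = b * g - q by rewrite sqr_sqrtr.
have a2 : Num.sqrt a ^+ 2 = a by rewrite sqr_sqrtr.
pose k := b + g + 2 * r.
have [k0|k0] := leP k 0.
  have [b0 g0 qz] : [/\ b = 0, g = 0 & q = 0] by rewrite /k in k0; split; nra.
  have u0 := spin_eq0 qz.
  exists (Num.sqrt a *: c1).
  by rewrite b0 g0 u0 !scale0r !addr0 jmulZl jmulZr c11 scalerA -expr2 a2.
pose s := Num.sqrt k.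
have s_gt0 : 0 < s by rewrite sqrtr_gt0.
have s2 : s ^+ 2 = k by rewrite sqr_sqrtr// ltW.
pose v := s^-1 *: u.
have [c1v c2v c3v] : [/\ c1 ** v = 0, c2 ** v = h *: v & c3 ** v = h *: v].
  by rewrite !jmulZr c1u c2u c3u scaler0 !scalerA mulrC.
(* Let [x] be the part of the element in the spin factor of [c2] and [c3],
   with trace [b + g] and determinant [r ^+ 2]. By Cayley-Hamilton its square
   root is [x + r] over the trace of the square root, whose square is [k]. *)
exists (Num.sqrt a *: c1 + ((b + r) / s) *: c2 + ((g + r) / s) *: c3 + v).
rewrite split_square// a2.
have qv : '<v, v> / (2 * n2) = q / k by rewrite !dotE -s2 /q; field;
  rewrite !gt_eqF.
rewrite qv; congr (_ + _ *: _ + _ *: _ + _).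
- rewrite exprMn exprVn s2; apply: (mulIf (lt0r_neq0 k0)).
  rewrite mulrDl !mulfVK ?gt_eqF//; rewrite /k; move: r2; lra.
- rewrite exprMn exprVn s2; apply: (mulIf (lt0r_neq0 k0)).
  rewrite mulrDl !mulfVK ?gt_eqF//; rewrite /k; move: r2; lra.
rewrite /v scalerA -mulrDl (_ : b + r + (g + r) = k); last by rewrite /k; ring.
by rewrite -s2 expr2 mulfK ?gt_eqF// divff ?gt_eqF// scale1r.
Qed.

Lemma isolated_facially_exposed :
  facially_exposed (self_adjoint (@jdot R E)) trace_form
    (completely_positive (@jdot R E) (square_cone E)).
Proof.
rewrite split_square_cone; have [c10 _ _] := p1.
apply: lorentz_product_facially_exposed => //.
- move=> x y; rewrite dotC !split_formE (dotC _ y x); field; by rewrite !gt_eqF.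
- apply: (dot_inj (dot := jdot)) => t;
  rewrite dotC split_formE dot0l d12 d13 (dotC _ t).
  by field; rewrite !gt_eqF.
- by rewrite /split_time !dotE d12 d13; ring.
move=> p; have [a [b [g [u [-> c1u c2u c3u]]]]] := split_decomposition p.
rewrite time_coordinate// form_coordinate// => bg det0.
have uu := dot_ge0 jdot u.
have q0 : 0 <= '<u, u> / (2 * n2) by rewrite divr_ge0 ?dot_ge0// mulr_ge0// ltW.
have [b0 g0 qz] : [/\ b = 0, g = 0 & '<u, u> / (2 * n2) = 0].
  have gE : g = - b by lra.
  have b2 : b ^+ 2 = 0 by have := sqr_ge0 b; rewrite gE in det0; lra.
  have b0 : b = 0 by apply/eqP; rewrite -sqrf_eq0 b2.
  by rewrite gE b0 oppr0 in det0 *; split=> //; lra.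
have u0 := spin_eq0 qz.
by exists a; rewrite b0 g0 u0 !scale0r !addr0.
Qed.
End Isolated.

Section Splitting.
Variables U W : {vspace E}.

Definition splitting (A B : {vspace E}) : Prop :=
  [/\ subalgebra A, subalgebra B, orthogonal_subalgebras A B &
      (A + B)%VS = fullv /\ (A :&: B)%VS = 0%VS].

Lemma splittingC : splitting U W -> splitting W U.
Proof.
move=> [sU sW oUW [full cap]]; split=> //; last by rewrite addvC capvC.
by move=> x y xW yU; rewrite jmulC oUW.
Qed.

Hypothesis sp : splitting U W.

Lemma splitting_components x : exists u w, [/\ u \in U, w \in W & x = u + w].
Proof.
have [_ _ _ [full _]] := sp; have : x \in fullv by apply: memvf.
by rewrite -full => /memv_addP[u uU [w wW ->]]; exists u, w.
Qed.

Lemma splitting_inj u w : u \in U -> w \in W -> u = w -> u = 0.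
Proof.
have [_ _ _ [_ cap]] := sp => uU wW uw.
by apply/eqP; rewrite -memv0 -cap memv_cap uU uw wW.
Qed.

(** The components of an idempotent are idempotents, so one of them vanishes
    when it is primitive. *)
Lemma primitive_in_factor c : primitive_idempotent c -> c \in U \/ c \in W.
Proof.
have [sU sW oUW _] := sp => -[c0 cc prim].
have [u [w [uU wW cE]]] := splitting_components c.
have uw : u ** w = 0 by apply: oUW.
have uwE : u ** u - u = w - w ** w.
  have := cc; rewrite /idempotent_elt cE jmulDl !jmulDr uw (jmulC w u) uw addr0
    add0r.
  move=> e; apply: (dot_inj (dot := jdot)) => t; have := congr1 (jdot^~ t) e.
  by rewrite !dotE; lra.
have uu0 : u ** u - u = 0.
  by apply: splitting_inj uwE; rewrite memvB// ?sU ?sW.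
have uu : u ** u = u by apply/eqP; rewrite -subr_eq0 uu0.
have ww : w ** w = w by apply/esym/eqP; rewrite -subr_eq0 -uwE uu0.
have [u0|u0] := eqVneq u 0; first by right; rewrite cE u0 add0r.
have [w0|w0] := eqVneq w 0; first by left; rewrite cE w0 addr0.
by case: prim; exists u, w.
Qed.

(** The multiplication by [c] is the projection onto [U]. *)
Lemma splitting_isolated c c' c'' : c \in U -> c' \in W -> c'' \in W ->
  c + c' + c'' = jone -> forall v, c ** v = h *: v -> v = 0.
Proof.
have [_ _ oUW _] := sp => cU cW cW' sum_c v cv.
have [u [w [uU wW vE]]] := splitting_components v.
have cu : c ** u = u.
  rewrite -[RHS]jmul1x -sum_c !jmulDl (jmulC c') (jmulC c'').
  by rewrite (oUW u c')// (oUW u c'')// !addr0.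
have uw : u = w.
  move: cv; rewrite vE jmulDr cu (oUW c w)// addr0 => e.
  by apply: (dot_inj (dot := jdot)) => t; have := congr1 (jdot^~ t) e;
    rewrite !dotE; lra.
by rewrite vE -uw (splitting_inj uU wW uw) addr0.
Qed.

Lemma unit_notin_factor : W <> 0%VS -> jone \in U -> False.
Proof.
have [_ _ oUW _] := sp => W0 oneU; apply: W0; apply/eqP; rewrite -subv0.
by apply/subvP => w wW; rewrite -(jmul1x w) (oUW jone w)// mem0v.
Qed.
End Splitting.

(** Of the three elements of the frame, one lies in a factor without the others:
    this one spans its factor. *)
Lemma not_simple_facially_exposed : has_rank E 3 -> ~ simple_eja E ->
  facially_exposed (self_adjoint (@jdot R E)) trace_form
    (completely_positive (@jdot R E) (square_cone E)).
Proof.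
move=> [c [pc oc sc]] nsimple.
pose c1 := c ord0; pose c2 := c (lift ord0 ord0); pose c3 := c ord_max.
have o3 : lift ord0 (lift ord0 ord0) = ord_max :> 'I_3 by apply: val_inj.
have sum_c : c1 + c2 + c3 = jone.
  by rewrite -sc !big_ord_recl big_ord0 addr0 addrA o3.
have [p1 p2 p3] : [/\ primitive_idempotent c1, primitive_idempotent c2 &
                      primitive_idempotent c3].
  by split; apply: pc.
have [c12 c13 c23] : [/\ c1 ** c2 = 0, c1 ** c3 = 0 & c2 ** c3 = 0].
  by split; apply: oc.
have c21 : c2 ** c1 = 0 by rewrite jmulC.
have c31 : c3 ** c1 = 0 by rewrite jmulC.
have s213 : c2 + c1 + c3 = jone by rewrite (addrC c2).
have s312 : c3 + c1 + c2 = jone by rewrite -addrA addrC.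
have [U [W [[sU sW] [U0 W0] oUW full dir]]] : exists U W : {vspace E},
    [/\ subalgebra U /\ subalgebra W, U <> 0%VS /\ W <> 0%VS,
        orthogonal_subalgebras U W, (U + W)%VS = fullv & directv (U + W)].
  apply: contra_notP nsimple => no; split=> //.
  case: p1 => c10 _ _ E0; have := memvf c1.
  by rewrite E0 memv0 (negPf c10).
have sp : splitting U W by split=> //; split=> //; apply/directv_addP.
have sp' := splittingC sp.
have iso1 A B (s : splitting A B) : c1 \in A -> c2 \in B -> c3 \in B -> _ :=
  fun a b b' => isolated_facially_exposed p1 p2 p3 c12 c13 c23 sum_c
    (splitting_isolated s a b b' sum_c).
have iso2 A B (s : splitting A B) : c2 \in A -> c1 \in B -> c3 \in B -> _ :=
  fun a b b' => isolated_facially_exposed p2 p1 p3 c21 c23 c13 s213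
    (splitting_isolated s a b b' s213).
have iso3 A B (s : splitting A B) : c3 \in A -> c1 \in B -> c2 \in B -> _ :=
  fun a b b' => isolated_facially_exposed p3 p1 p2 c31 (etrans (jmulC _ _) c23)
    c12 s312
    (splitting_isolated s a b b' s312).
have [m1|m1] := primitive_in_factor sp p1;
  have [m2|m2] := primitive_in_factor sp p2;
  have [m3|m3] := primitive_in_factor sp p3.
- by case: (unit_notin_factor sp W0); rewrite -sum_c !memvD.
- exact: (iso3 _ _ sp').
- exact: (iso2 _ _ sp').
- exact: (iso1 _ _ sp).
- exact: (iso1 _ _ sp').
- exact: (iso2 _ _ sp).
- exact: (iso3 _ _ sp).
- by case: (unit_notin_factor sp' U0); rewrite -sum_c !memvD.
Qed.
End SplitAlgebra.

Theorem theorem4p6 (R : realType) (E : ejaType R) (rank3 : has_rank E 3) :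
  facially_exposed (self_adjoint (@jdot R E)) trace_form
    (completely_positive (@jdot R E) (square_cone E))
  <-> ~ simple_eja E.
Proof.
split; last exact: not_simple_facially_exposed.
by move=> exposed simple; apply: simple_not_facially_exposed exposed.
Qed.
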